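(* For every pair $\mathcal{A},\mathcal{B}$ of conic quantum spaces and every linear bijection $\widehat{\tau}:\mathbf{B}_1\otimes(\mathbf{B}_1^*\otimes\mathbf{A}_1)\to\mathbf{B}_1\otimes(\mathbf{B}_1^*\otimes\mathbf{A}_1)$, the category $\Upsilon^{\mathcal{A},\mathcal{B}}$ associated to $\widehat{\tau}$ has an initial object.
   Context: $\Bbbk$ is $\mathbb{R}$ or $\mathbb{C}$; algebras are unital associative $\Bbbk$-algebras. FGA is the category whose objects (quantum spaces) are pairs $\mathcal{A}=(\mathbf{A}_1,\mathbf{A})$, where $\mathbf{A}$ is an algebra generated by a finite-dimensional linear subspace $\mathbf{A}_1\subset\mathbf{A}$, and whose morphisms $(\mathbf{A}_1,\mathbf{A})\to(\mathbf{B}_1,\mathbf{B})$ are algebra homomorphisms $\alpha:\mathbf{A}\to\mathbf{B}$ with $\alpha(\mathbf{A}_1)\subset\mathbf{B}_1$. CA (conic quantum spaces) is the full subcategory of FGA of pairs such that the kernel of the canonical epimorphism $\Pi:\mathbf{A}_1^{\otimes}\to\mathbf{A}$ ($\mathbf{A}_1^{\otimes}$ the tensor algebra) is graded, $\ker\Pi=\bigoplus_n\mathbf{I}_n$, $\mathbf{I}_n\subset\mathbf{A}_1^{\otimes n}$, $\mathbf{I}_0=\mathbf{I}_1=0$; so $\mathbf{A}=\bigoplus_n\mathbf{A}_n$ with $\mathbf{A}_n=\Pi(\mathbf{A}_1^{\otimes n})$. $\mathcal{A}\circ\mathcal{B}=(\mathbf{A}_1\otimes\mathbf{B}_1,\mathbf{A}\circ\mathbf{B})$,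 where $\mathbf{A}\circ\mathbf{B}$ is the subalgebra of $\mathbf{A}\otimes\mathbf{B}$ generated by $\mathbf{A}_1\otimes\mathbf{B}_1$; for morphisms, $\alpha\circ\beta$ is the restriction of $\alpha\otimes\beta$. In CA, $\mathbf{A}\circ\mathbf{B}=\bigoplus_n\mathbf{A}_n\otimes\mathbf{B}_n$. Twisting maps: for algebras $\mathbf{H},\mathbf{B}$, a linear map $\tau:\mathbf{B}\otimes\mathbf{H}\to\mathbf{H}\otimes\mathbf{B}$ is a twisting map if $\tau(m_B\otimes I)=(I\otimes m_B)(\tau\otimes I)(I\otimes\tau)$, $\tau(I\otimes m_H)=(m_H\otimes I)(I\otimes\tau)(\tau\otimes I)$, $\tau(b\otimes1)=1\otimes b$, $\tau(1\otimes h)=h\otimes1$. Then $\mathbf{H}\otimes_\tau\mathbf{B}$ is the algebra on $\mathbf{H}\otimes\mathbf{B}$ with product $(m_H\otimes m_B)(I\otimes\tau\otimes I)$ and unit $1\otimes1$. For quantum spaces $\mathcal{H},\mathcal{B}$, $\tau$ is symmetric if it is bijective and $\tau(\mathbf{B}_1\otimes\mathbf{H}_1)\subset\mathbf{H}_1\otimes\mathbf{B}_1$; and $\mathcal{H}\circ_\tau\mathcal{B}=(\mathbf{H}_1\otimes\mathbf{B}_1,\mathbf{H}\circ_\tau\mathbf{B})$, with $\mathbf{H}\circ_\tau\mathbf{B}$ the subalgebra of $\mathbf{H}\otimes_\tau\mathbf{B}$ generated by $\mathbf{H}_1\otimes\mathbf{B}_1$. The comma category $(\mathfrak{H}\mathcal{A}\downarrow\mathfrak{H}(\mathrm{CA}\circ\mathcal{B}))$: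 objects are pairs $\langle\varphi,\mathcal{H}\rangle$ with $\mathcal{H}\in\mathrm{CA}$ and $\varphi:\mathbf{A}\to\mathbf{H}\circ\mathbf{B}$ a homogeneous linear map ($\varphi(\mathbf{A}_n)\subset\mathbf{H}_n\otimes\mathbf{B}_n$); arrows $\langle\varphi,\mathcal{H}\rangle\to\langle\varphi',\mathcal{H}'\rangle$ are morphisms $\alpha:\mathcal{H}\to\mathcal{H}'$ in CA with $\varphi'=(\alpha\circ I_B)\varphi$. Given bases $\{a_i\}$ of $\mathbf{A}_1$, $\{b_j\}$ of $\mathbf{B}_1$ (dual basis $\{b^j\}$), write $\varphi(a_i)=\sum_jh_i^j\otimes b_j$; put $\mathbf{H}_1^\varphi=\mathrm{span}\{h_i^j\}\subset\mathbf{H}_1$, $\mathbf{H}^\varphi$ = subalgebra of $\mathbf{H}$ generated by $\mathbf{H}_1^\varphi$, $\mathcal{H}^\varphi=(\mathbf{H}_1^\varphi,\mathbf{H}^\varphi)$, and $\pi^\varphi:\mathbf{B}_1^*\otimes\mathbf{A}_1\to\mathbf{H}_1^\varphi$ the surjection $b^j\otimes a_i\mapsto h_i^j$. Definition of $\Upsilon^{\mathcal{A},\mathcal{B}}$: given a linear bijection $\widehat\tau$ of $\mathbf{B}_1\otimes\mathbf{B}_1^*\otimes\mathbf{A}_1$, it is the full subcategory of $(\mathfrak{H}\mathcal{A}\downarrow\mathfrak{H}(\mathrm{CA}\circ\mathcal{B}))$ formed by the $\langle\varphi,\mathcal{H}\rangle$ such that (i) $\widehat\tau$ descends through $I\otimes\pi^\varphi$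 to a map $\widehat\tau^\varphi$ of $\mathbf{B}_1\otimes\mathbf{H}_1^\varphi$, and $\tau_o\widehat\tau^\varphi:\mathbf{B}_1\otimes\mathbf{H}_1^\varphi\to\mathbf{H}_1^\varphi\otimes\mathbf{B}_1$ ($\tau_o$ the flip) extends to a symmetric twisting map $\tau:\mathbf{B}\otimes\mathbf{H}^\varphi\to\mathbf{H}^\varphi\otimes\mathbf{B}$ (necessarily unique); (ii) $\varphi$ is a morphism of quantum spaces $\mathcal{A}\to\mathcal{H}^\varphi\circ_\tau\mathcal{B}$. *)

(* Defs.v *)
From HB Require Import structures.
From mathcomp Require Import all_boot all_order all_algebra sesquilinear.
From mathcomp Require Import generic_quotient complex.
From mathcomp Require Import boolp classical_sets functions reals.

Set Implicit Arguments.
Unset Strict Implicit.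
Unset Printing Implicit Defensive.

Import GRing.Theory.
Local Open Scope ring_scope.
Local Open Scope quotient_scope.
Local Open Scope classical_set_scope.

(* Tensor product of two vector spaces: a list [:: (v1, w1); ...; (vk, wk)]   *)
(* stands for the formal sum v1 (x) w1 + ... + vk (x) wk, and two formal sums *)
(* are identified when no bilinear map distinguishes them.                    *)
Section TensorType.
Variables (K : fieldType) (V W : lmodType K).
Implicit Types s t : seq (V * W).

Definition tsum (U : lmodType K) (f : V -> W -> U) s : U :=
  \sum_(p <- s) f p.1 p.2.

Definition tens_rel : rel (seq (V * W)) := fun s t =>
  `[< forall (U : lmodType K) (f : {bilinear V -> W -> U}),
        tsum f s = tsum f t >].

Lemma tens_relP s t : reflect
  (forall (U : lmodType K) (f : {bilinear V -> W -> U}), tsum f s = tsum f t)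
  (tens_rel s t).
Proof. exact: asboolP. Qed.

Lemma tens_rel_refl : reflexive tens_rel.
Proof. by move=> s; apply/tens_relP. Qed.

Lemma tens_rel_sym : symmetric tens_rel.
Proof.
by move=> s t; apply/tens_relP/tens_relP => st U f; rewrite st.
Qed.

Lemma tens_rel_trans : transitive tens_rel.
Proof.
by move=> t s u /tens_relP st /tens_relP tu; apply/tens_relP => U f; rewrite st.
Qed.

Canonical tens_equiv := EquivRel tens_rel tens_rel_refl tens_rel_sym
  tens_rel_trans.

Definition tens : Type := {eq_quot tens_equiv}.

HB.instance Definition _ := Choice.on tens.
HB.instance Definition _ := Quotient.on tens.
HB.instance Definition _ := EqQuotient.on tens.

Lemma tens_eqP s t : reflect (\pi_tens s = \pi_tens t) (tens_rel s t).
Proof. by apply: (iffP idP) => [st|/eqmodP//]; apply/eqmodP. Qed.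

Lemma tsum_repr (U : lmodType K) (f : {bilinear V -> W -> U}) s :
  tsum f (repr (\pi_tens s)) = tsum f s.
Proof. by apply/tens_relP/tens_eqP; rewrite reprK. Qed.

Definition tscale_seq (c : K) s := [seq (c *: p.1, p.2) | p <- s].

Lemma tsum_cat (U : lmodType K) (f : V -> W -> U) s t :
  tsum f (s ++ t) = tsum f s + tsum f t.
Proof. by rewrite /tsum big_cat. Qed.

Lemma tsum_scale (U : lmodType K) (f : {bilinear V -> W -> U}) c s :
  tsum f (tscale_seq c s) = c *: tsum f s.
Proof.
rewrite /tsum big_map scaler_sumr; apply: eq_bigr => p _ /=.
by rewrite linearZl_LR.
Qed.

Definition tens0 : tens := \pi_tens [::].
Definition tens_add (x y : tens) : tens := \pi_tens (repr x ++ repr y).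
Definition tens_scale (c : K) (x : tens) : tens :=
  \pi_tens (tscale_seq c (repr x)).
Definition tens_opp (x : tens) : tens := tens_scale (- 1) x.

Lemma tensP (x y : tens) :
  (forall (U : lmodType K) (f : {bilinear V -> W -> U}),
     tsum f (repr x) = tsum f (repr y)) -> x = y.
Proof.
by move=> xy; rewrite -[x]reprK -[y]reprK; apply/tens_eqP/tens_relP.
Qed.

Lemma tsum_add (U : lmodType K) (f : {bilinear V -> W -> U}) (x y : tens) :
  tsum f (repr (tens_add x y)) = tsum f (repr x) + tsum f (repr y).
Proof. by rewrite tsum_repr tsum_cat. Qed.

Lemma tsum_tscale (U : lmodType K) (f : {bilinear V -> W -> U}) c (x : tens) :
  tsum f (repr (tens_scale c x)) = c *: tsum f (repr x).
Proof. by rewrite tsum_repr tsum_scale. Qed.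

Lemma tsum_0 (U : lmodType K) (f : {bilinear V -> W -> U}) :
  tsum f (repr tens0) = 0.
Proof. by rewrite tsum_repr /tsum big_nil. Qed.

Let tsumE := (tsum_add, tsum_tscale, tsum_0).

Lemma tens_addA : associative tens_add.
Proof. by move=> x y z; apply: tensP => U f; rewrite !tsumE addrA. Qed.
Lemma tens_addC : commutative tens_add.
Proof. by move=> x y; apply: tensP => U f; rewrite !tsumE addrC. Qed.
Lemma tens_add0 : left_id tens0 tens_add.
Proof. by move=> x; apply: tensP => U f; rewrite !tsumE add0r. Qed.
Lemma tens_addN : left_inverse tens0 tens_opp tens_add.
Proof.
by move=> x; apply: tensP => U f; rewrite !tsumE scaleN1r addNr.
Qed.

HB.instance Definition _ :=
  GRing.isZmodule.Build tens tens_addA tens_addC tens_add0 tens_addN.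

Lemma tens_scaleA a b (x : tens) :
  tens_scale a (tens_scale b x) = tens_scale (a * b) x.
Proof. by apply: tensP => U f; rewrite !tsumE scalerA. Qed.
Lemma tens_scale1 : left_id 1 tens_scale.
Proof. by move=> x; apply: tensP => U f; rewrite !tsumE scale1r. Qed.
Lemma tens_scaleDr : right_distributive tens_scale +%R.
Proof. by move=> a x y; apply: tensP => U f; rewrite !tsumE scalerDr. Qed.
Lemma tens_scaleDl x : {morph tens_scale^~ x : a b / a + b}.
Proof. by move=> a b; apply: tensP => U f; rewrite !tsumE scalerDl. Qed.

HB.instance Definition _ := GRing.Zmodule_isLmodule.Build K tens
  tens_scaleA tens_scale1 tens_scaleDr tens_scaleDl.

Definition tensor (v : V) (w : W) : tens := \pi_tens [:: (v, w)].

Definition tlift (U : lmodType K) (f : {bilinear V -> W -> U}) (x : tens) : U :=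
  tsum f (repr x).

Section Lift.
Variables (U : lmodType K) (f : {bilinear V -> W -> U}).

Lemma tlift_linear : linear (tlift f).
Proof. by move=> c x y; rewrite /tlift tsum_add tsum_tscale. Qed.

HB.instance Definition _ :=
  GRing.isLinear.Build K tens U *:%R (tlift f) tlift_linear.

Lemma tliftE v w : tlift f (tensor v w) = f v w.
Proof. by rewrite /tlift tsum_repr /tsum big_seq1. Qed.
End Lift.

Lemma tensor_bilinear : bilinear_for *:%R *:%R tensor.
Proof.
split=> [w|v] c x y /=; apply: tensP => U f;
  rewrite tsum_add tsum_tscale !tsum_repr /tsum !big_seq1 /=.
  by rewrite linearPl.
by rewrite linearPr.
Qed.

HB.instance Definition _ :=
  bilinear_isBilinear.Build K V W tens *:%R *:%R tensor tensor_bilinear.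

Lemma tens_sumE (x : tens) : exists s : seq (V * W),
  x = \sum_(p <- s) tensor p.1 p.2.
Proof.
exists (repr x); apply: tensP => U f.
rewrite -[RHS]/(tlift f _) linear_sum; apply: eq_bigr => p _.
by rewrite /= tliftE.
Qed.

Lemma tlift_sum (U : lmodType K) (f : {bilinear V -> W -> U}) s :
  tlift f (\sum_(p <- s) tensor p.1 p.2) = \sum_(p <- s) f p.1 p.2.
Proof.
by rewrite [LHS]linear_sum; apply: eq_bigr => p _; rewrite /= tliftE.
Qed.

Lemma tens_ext (U : lmodType K) (f g : {linear tens -> U}) :
  (forall v w, f (tensor v w) = g (tensor v w)) -> f =1 g.
Proof.
move=> fg x; have [s ->] := tens_sumE x.
by rewrite !linear_sum; apply: eq_bigr => p _; apply: fg.
Qed.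

End TensorType.

Arguments tensor {K V W}.
Notation "v ⊗ w" := (tensor v w) (at level 40, left associativity).

Section TensorMaps.
Variable K : fieldType.
Implicit Types U V W : lmodType K.

Section Map.
Variables (V V' W W' : lmodType K).
Variables (f : {linear V -> V'}) (g : {linear W -> W'}).
Definition tmap_fun (v : V) (w : W) : tens V' W' := f v ⊗ g w.
Lemma tmap_bilinear : bilinear_for *:%R *:%R tmap_fun.
Proof.
by split=> [w|v] c x y /=; rewrite /tmap_fun linearP ?linearPl ?linearPr.
Qed.
HB.instance Definition _ :=
  bilinear_isBilinear.Build K V W (tens V' W') *:%R *:%R tmap_fun tmap_bilinear.
Definition tmap : {linear tens V W -> tens V' W'} := tlift tmap_fun.
Lemma tmapE v w : tmap (v ⊗ w) = f v ⊗ g w.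
Proof. exact: tliftE. Qed.
End Map.

Section Flip.
Variables V W : lmodType K.
Definition tflip_fun (v : V) (w : W) : tens W V := w ⊗ v.
Lemma tflip_bilinear : bilinear_for *:%R *:%R tflip_fun.
Proof.
by split=> [w|v] c x y /=; rewrite /tflip_fun ?linearPl ?linearPr.
Qed.
HB.instance Definition _ :=
  bilinear_isBilinear.Build K V W (tens W V) *:%R *:%R tflip_fun tflip_bilinear.
Definition tflip : {linear tens V W -> tens W V} := tlift tflip_fun.
Lemma tflipE v w : tflip (v ⊗ w) = w ⊗ v.
Proof. exact: tliftE. Qed.
End Flip.

Section Assoc.
Variables U V W : lmodType K.

Definition tassoc1 (w : W) (u : U) (v : V) : tens U (tens V W) := u ⊗ (v ⊗ w).
Lemma tassoc1_bilinear w : bilinear_for *:%R *:%R (tassoc1 w).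
Proof.
by split=> [v|u] c x y /=; rewrite /tassoc1 ?linearPl ?linearPr.
Qed.
HB.instance Definition _ w := bilinear_isBilinear.Build K U V _ *:%R *:%R
  (tassoc1 w) (tassoc1_bilinear w).

Definition tassoc2 (x : tens U V) (w : W) := tlift (tassoc1 w) x.
Lemma tassoc2_bilinear : bilinear_for *:%R *:%R tassoc2.
Proof.
split=> [w|x] c y z /=; first by rewrite /tassoc2 linearP.
have [s ->] := tens_sumE x; rewrite /tassoc2 !tlift_sum scaler_sumr -big_split.
apply: eq_bigr => p _ /=; rewrite /tassoc1.
by rewrite !linearPr.
Qed.
HB.instance Definition _ := bilinear_isBilinear.Build K (tens U V) W _ *:%R *:%R
  tassoc2 tassoc2_bilinear.
Definition tassoc : {linear tens (tens U V) W -> tens U (tens V W)} :=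
  tlift tassoc2.
Lemma tassocE u v w : tassoc (u ⊗ v ⊗ w) = u ⊗ (v ⊗ w).
Proof. by rewrite [LHS]tliftE /= /tassoc2 tliftE. Qed.

Definition tassocV1 (u : U) (v : V) (w : W) : tens (tens U V) W := u ⊗ v ⊗ w.
Lemma tassocV1_bilinear u : bilinear_for *:%R *:%R (tassocV1 u).
Proof.
by split=> [w|v] c x y /=; rewrite /tassocV1 ?linearPl ?linearPr ?linearPl.
Qed.
HB.instance Definition _ u := bilinear_isBilinear.Build K V W _ *:%R *:%R
  (tassocV1 u) (tassocV1_bilinear u).

Definition tassocV2 (u : U) (x : tens V W) := tlift (tassocV1 u) x.
Lemma tassocV2_bilinear : bilinear_for *:%R *:%R tassocV2.
Proof.
split=> [x|u] c y z /=; last by rewrite /tassocV2 linearP.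
have [s ->] := tens_sumE x; rewrite /tassocV2 !tlift_sum scaler_sumr -big_split.
apply: eq_bigr => p _ /=; rewrite /tassocV1.
by rewrite !linearPl.
Qed.
HB.instance Definition _ := bilinear_isBilinear.Build K U (tens V W) _ *:%R *:%R
  tassocV2 tassocV2_bilinear.
Definition tassocV : {linear tens U (tens V W) -> tens (tens U V) W} :=
  tlift tassocV2.
Lemma tassocVE u v w : tassocV (u ⊗ (v ⊗ w)) = u ⊗ v ⊗ w.
Proof. by rewrite [LHS]tliftE /= /tassocV2 tliftE. Qed.
End Assoc.

Section Mult.
Variable A : algType K.
Definition tmul_fun (x y : A) : A := x * y.
Lemma tmul_bilinear : bilinear_for *:%R *:%R tmul_fun.
Proof.
split=> [z|z] c x y /=; rewrite /tmul_fun.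
  by rewrite mulrDl scalerAl.
by rewrite mulrDr scalerAr.
Qed.
HB.instance Definition _ := bilinear_isBilinear.Build K A A A *:%R *:%R
  tmul_fun tmul_bilinear.
Definition tmul : {linear tens A A -> A} := tlift tmul_fun.
Lemma tmulE x y : tmul (x ⊗ y) = x * y.
Proof. exact: tliftE. Qed.
End Mult.

(* K is the 0-th tensor power, and V^(x)(n+1) = V (x) V^(x)n. *)
Fixpoint tpow V n : lmodType K :=
  if n is n'.+1 then tens V (tpow V n') : lmodType K else K^o.

End TensorMaps.

Arguments tmap {K V V' W W'}.
Arguments tflip {K V W}.
Arguments tassoc {K U V W}.
Arguments tassocV {K U V W}.
Arguments tmul {K A}.
Arguments tpow {K}.

Section Subspaces.
Variable K : fieldType.

Section Sub.
Variables (V : lmodType K) (S : submodClosed V).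
Record subsp : predArgType := Subsp { subsp_val :> V; _ : subsp_val \in S }.
HB.instance Definition _ := [isSub for subsp_val].
HB.instance Definition _ := [Choice of subsp by <:].
HB.instance Definition _ := [SubChoice_isSubLmodule of subsp by <:].
HB.instance Definition _ :=
  GRing.Linear.copy subsp_val (val : subsp -> V).
End Sub.

Section SubAlg.
Variables (A : algType K) (S : subalgClosed A).
Record subal : predArgType := Subal { subal_val :> A; _ : subal_val \in S }.
HB.instance Definition _ := [isSub for subal_val].
HB.instance Definition _ := [Choice of subal by <:].
HB.instance Definition _ := [SubChoice_isSubAlgebra of subal by <:].
HB.instance Definition _ :=
  GRing.RMorphism.copy subal_val (val : subal -> A).
HB.instance Definition _ :=
  GRing.Linear.copy subal_val (val : subal -> A).
End SubAlg.


Section Span.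
Variables (V : lmodType K) (X : set V).
Definition span : {pred V} := [pred x |
  `[< forall S : submodClosed V, X `<=` [set` S] -> x \in S >]].
Lemma span_closed : subsemimod_closed span.
Proof.
split; first split=> [|x y /asboolP xS /asboolP yS]; last 1 first.
- move=> c x /asboolP xS; apply/asboolP => S XS.
  exact/rpredZ/xS.
- by apply/asboolP => S XS; exact: rpred0.
- by apply/asboolP => S XS; apply: rpredD; [exact: xS|exact: yS].
Qed.
HB.instance Definition _ := GRing.isSubSemiModClosed.Build K V span span_closed.
Lemma sub_span : X `<=` [set` span].
Proof. by move=> x Xx; apply/asboolP => S; exact. Qed.
Lemma span_min (S : submodClosed V) : X `<=` [set` S] -> {subset span <= S}.
Proof. by move=> XS x /asboolP; exact. Qed.
End Span.

Section Generated.
Variables (A : algType K) (X : set A).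
Definition subalg_gen : {pred A} := [pred x |
  `[< forall S : subalgClosed A, X `<=` [set` S] -> x \in S >]].
Lemma subalg_gen_closed : GRing.subsemialg_closed subalg_gen.
Proof.
split=> [|||x y /asboolP xS /asboolP yS].
- by apply/asboolP => S XS; exact: rpred1.
- split=> [|x y /asboolP xS /asboolP yS].
    by apply/asboolP => S XS; exact: rpred0.
  by apply/asboolP => S XS; apply: rpredD; [exact: xS|exact: yS].
- move=> c x /asboolP xS; apply/asboolP => S XS.
  exact/rpredZ/xS.
- by apply/asboolP => S XS; apply: rpredM; [exact: xS|exact: yS].
Qed.
HB.instance Definition _ :=
  GRing.isSubSemiAlgClosed.Build K A subalg_gen subalg_gen_closed.
Lemma sub_subalg_gen : X `<=` [set` subalg_gen].
Proof. by move=> x Xx; apply/asboolP => S; exact. Qed.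
Lemma subalg_gen_min (S : subalgClosed A) :
  X `<=` [set` S] -> {subset subalg_gen <= S}.
Proof. by move=> XS x /asboolP; exact. Qed.
End Generated.

Section LinearImage.
Variables (V W : lmodType K) (f : {linear V -> W}) (S : submodClosed V).
Definition lin_img : {pred W} := [pred y | `[< exists2 x, x \in S & f x = y >]].
Lemma lin_img_closed : subsemimod_closed lin_img.
Proof.
split; first split=> [|_ _ /asboolP[x xS <-] /asboolP[y yS <-]]; last 1 first.
- move=> c _ /asboolP[x xS <-]; apply/asboolP.
  by exists (c *: x); [exact: rpredZ|rewrite linearZ].
- by apply/asboolP; exists 0; [exact: rpred0|rewrite raddf0].
- by apply/asboolP; exists (x + y); [exact: rpredD|rewrite raddfD].
Qed.
HB.instance Definition _ :=
  GRing.isSubSemiModClosed.Build K W lin_img lin_img_closed.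
End LinearImage.

Section AlgebraImage.
Variables (A B : algType K) (f : {lrmorphism A -> B}) (S : subalgClosed A).
Definition alg_img : {pred B} := [pred y | `[< exists2 x, x \in S & f x = y >]].
Lemma alg_img_closed : GRing.subsemialg_closed alg_img.
Proof.
split=> [|||_ _ /asboolP[x xS <-] /asboolP[y yS <-]].
- by apply/asboolP; exists 1; [exact: rpred1|rewrite rmorph1].
- split=> [|_ _ /asboolP[x xS <-] /asboolP[y yS <-]].
    by apply/asboolP; exists 0; [exact: rpred0|rewrite raddf0].
  by apply/asboolP; exists (x + y); [exact: rpredD|rewrite raddfD].
- move=> c _ /asboolP[x xS <-]; apply/asboolP.
  by exists (c *: x); [exact: rpredZ|rewrite linearZ].
- by apply/asboolP; exists (x * y); [exact: rpredM|rewrite rmorphM].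
Qed.
HB.instance Definition _ :=
  GRing.isSubSemiAlgClosed.Build K B alg_img alg_img_closed.
End AlgebraImage.

Section Dual.
Variable V : lmodType K.
Definition dual_pred : {pred V -> K^o} := [pred f | `[< linear f >]].
Lemma dual_closed : subsemimod_closed dual_pred.
Proof.
split; first split=> [|f g /asboolP fl /asboolP gl]; last 1 first.
- move=> c f /asboolP fl; apply/asboolP => d x y.
  by rewrite -[LHS]/(c *: f (d *: x + y)) fl scalerDr !scalerA mulrC -scalerA.
- by apply/asboolP => d x y; rewrite -[LHS]/(0 : K^o) scaler0 addr0.
- apply/asboolP => d x y.
  rewrite -[LHS]/(f (d *: x + y) + g (d *: x + y)) fl gl scalerDr.
  by rewrite addrACA.
Qed.
HB.instance Definition _ :=
  GRing.isSubSemiModClosed.Build K (V -> K^o) dual_pred dual_closed.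
Definition dual : lmodType K := subsp dual_pred.
End Dual.

Definition basis (V : lmodType K) n (e : 'I_n -> V) : Prop :=
  forall x : V, exists! c : 'I_n -> K, x = \sum_i c i *: e i.

Definition dual_basis (V : lmodType K) n (e : 'I_n -> V) (e' : 'I_n -> dual V) :
  Prop := forall j k, subsp_val (e' j) (e k) = (j == k)%:R.

End Subspaces.

Arguments subsp_val {K V S}.
Arguments subal_val {K A S}.

Section QuantumSpaces.
Variable K : fieldType.

(* An algType is a nonzero algebra; the zero algebra is never conic, since    *)
(* the kernel of the canonical epimorphism would contain the scalars.         *)
Record qspace := QSpace {
  qalg :> algType K;
  qgen : submodClosed qalg;
  qgen_fin : exists s : seq qalg, qgen =i span [set` s];
  qgen_gen : subalg_gen [set` qgen] =i predT
}.

Definition qgenT (A : qspace) : lmodType K := subsp (qgen A).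

Record qmorph (A B : qspace) := QMorph {
  qmorph_fun :> {lrmorphism A -> B};
  qmorph_gen : forall x, x \in qgen A -> qmorph_fun x \in qgen B
}.

Section ScalarMap.
Variable A : algType K.
Definition scalar_fun (c : K^o) : A := c%:A.
Lemma scalar_fun_linear : linear scalar_fun.
Proof. by move=> c x y; rewrite /scalar_fun scalerDl scalerA. Qed.
HB.instance Definition _ :=
  GRing.isLinear.Build K K^o A *:%R scalar_fun scalar_fun_linear.
Definition scalar_map : {linear K^o -> A} := scalar_fun.
End ScalarMap.

(* Restriction of the canonical epimorphism from the tensor algebra of A_1 to *)
(* the tensors of degree n.                                                   *)
Fixpoint qproj (A : qspace) n : {linear tpow (qgenT A) n -> A} :=
  match n return {linear tpow (qgenT A) n -> A} with
  | 0 => scalar_map A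
  | n'.+1 => tmul \o tmap subsp_val (qproj A n')
  end.

Definition qcomp (A : qspace) n : set A := range (qproj A n).

(* An element of the tensor algebra is a finite sum of homogeneous tensors    *)
(* t 0 + ... + t (N - 1); the kernel is graded when it contains the           *)
(* components of each of its elements.                                        *)
Record conic (A : qspace) : Prop := Conic {
  conic_graded : forall N (t : forall n, tpow (qgenT A) n),
    \sum_(n < N) qproj A n (t n) = 0 ->
    forall n, (n < N)%N -> qproj A n (t n) = 0;
  conic_deg0 : forall t, qproj A 0 t = 0 -> t = 0;
  conic_deg1 : forall t, qproj A 1 t = 0 -> t = 0
}.

Record cqspace := CQSpace { cqspace_q :> qspace; cqspaceP : conic cqspace_q }.

(* The image in V (x) W of the tensor product of the spans of X and Y.        *)
Definition tsub (V W : lmodType K) (X : set V) (Y : set W) : {pred tens V W} :=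
  span [set z | exists x y, [/\ X x, Y y & z = x ⊗ y]].
HB.instance Definition _ (V W : lmodType K) (X : set V) (Y : set W) :=
  GRing.SubmodClosed.on (tsub X Y).

Section Twist.
Variables H B : algType K.
Variable tau : {linear tens B H -> tens H B}.

Record twisting : Prop := Twisting {
  twisting_mulB : forall x : tens (tens B B) H,
    tau (tmap tmul idfun x) =
    tmap idfun tmul (tassoc (tmap tau idfun (tassocV
      (tmap idfun tau (tassoc x)))));
  twisting_mulH : forall x : tens B (tens H H),
    tau (tmap idfun tmul x) =
    tmap tmul idfun (tassocV (tmap idfun tau (tassoc
      (tmap tau idfun (tassocV x)))));
  twisting_1H : forall b : B, tau (b ⊗ 1) = 1 ⊗ b;
  twisting_1B : forall h : H, tau (1 ⊗ h) = h ⊗ 1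
}.

Definition twist_mul (x y : tens H B) : tens H B :=
  tmap tmul tmul (tassocV (tmap idfun tassoc (tmap idfun (tmap tau idfun)
    (tmap idfun tassocV (tassoc (x ⊗ y)))))).

Lemma twist_mulE h b h' b' : twist_mul (h ⊗ b) (h' ⊗ b') =
  tmap tmul tmul (tassocV (tmap idfun tassoc (h ⊗ (tau (b ⊗ h') ⊗ b')))).
Proof. by rewrite /twist_mul tassocE !tmapE tassocVE !tmapE. Qed.
End Twist.

Lemma flip_mulE (H B : algType K) (h h' : H) (b b' : B) :
  twist_mul tflip (h ⊗ b) (h' ⊗ b') = (h * h') ⊗ (b * b').
Proof.
by rewrite twist_mulE tflipE !tmapE tassocE tassocVE !tmapE !tmulE.
Qed.

Section Circle.
Variables H B : qspace.

Definition symmetric_twist (tau : {linear tens B H -> tens H B}) : Prop :=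
  bijective tau /\
  forall x, x \in tsub [set` qgen B] [set` qgen H] ->
    tau x \in tsub [set` qgen H] [set` qgen B].

(* The subalgebra of the twisted tensor product of H and B generated by       *)
(* H_1 (x) B_1.                                                               *)
Definition circ_tau (tau : {linear tens B H -> tens H B}) : {pred tens H B} :=
  [pred x | `[< forall S : submodClosed (tens H B), 1 ⊗ 1 \in S ->
    {in S &, forall y z, twist_mul tau y z \in S} ->
    {subset tsub [set` qgen H] [set` qgen B] <= S} -> x \in S >]].

(* Twisting by the flip gives the usual product (flip_mulE).                  *)
Definition circ : {pred tens H B} := circ_tau tflip.
End Circle.

(* psi is a morphism of quantum spaces from A to (H_1 (x) B_1, circ_tau tau). *)
Record circ_morph (A H B : qspace) (tau : {linear tens B H -> tens H B})
    (psi : {linear A -> tens H B}) : Prop := CircMorph {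
  circ_morph_in : forall x, psi x \in circ_tau tau;
  circ_morph1 : psi 1 = 1 ⊗ 1;
  circ_morphM : forall x y, psi (x * y) = twist_mul tau (psi x) (psi y);
  circ_morph_gen : forall x, x \in qgen A ->
    psi x \in tsub [set` qgen H] [set` qgen B]
}.

Section GeneratedSpace.
Variables (A : algType K) (s : seq A).

Definition gen_alg : algType K := subal (subalg_gen [set` s]).

Definition gen_gen : {pred gen_alg} := [pred x | subal_val x \in span [set` s]].
Lemma gen_gen_closed : subsemimod_closed gen_gen.
Proof.
pose v : {linear gen_alg -> A} := subal_val.
have E x : (x \in gen_gen) = (v x \in span [set` s]) by [].
split=> [|c x]; last by rewrite !E linearZ; exact: rpredZ.
split=> [|x y]; first by rewrite E raddf0 rpred0.
by rewrite !E raddfD; exact: rpredD.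
Qed.
HB.instance Definition _ :=
  GRing.isSubSemiModClosed.Build K gen_alg gen_gen gen_gen_closed.

Lemma gen_sub x : x \in s -> x \in subalg_gen [set` s].
Proof. by move=> xs; apply: sub_subalg_gen. Qed.

Lemma gen_fin : exists r : seq gen_alg, gen_gen =i span [set` r].
Proof.
pose r : seq gen_alg := pmap insub s; exists r => x; apply/idP/idP.
  move=> xs; have /asboolP[y yr /val_inj <- //] : val x \in
      lin_img subal_val (span [set` r]).
  apply: span_min xs => y /= ys; apply/asboolP.
  exists (Subal (gen_sub ys)) => //; apply: sub_span.
  by rewrite /= mem_pmap_sub.
apply: span_min => y /=; rewrite mem_pmap_sub => ys.
exact: (@sub_span K A [set` s] (val y)).
Qed.

Lemma gen_genP : subalg_gen [set` gen_gen] =i predT.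
Proof.
move=> x; rewrite [RHS]inE; apply/asboolP => S gS.
have /asboolP[y yS /val_inj <- //] :
    val x \in alg_img subal_val S.
apply: subalg_gen_min (valP x) => y /= ys; apply/asboolP.
exists (Subal (gen_sub ys)) => //; apply: gS.
exact: (@sub_span K A [set` s] y).
Qed.

Definition gen_qspace : qspace := QSpace gen_fin gen_genP.
End GeneratedSpace.

End QuantumSpaces.

Arguments qgen {K}.
Arguments qgenT {K}.
Arguments qproj {K}.
Arguments qcomp {K}.
Arguments circ {K}.

Section CommaCategory.
Variables (K : fieldType) (A B : cqspace K).

Record comma := Comma {
  comma_H : cqspace K;
  comma_phi : {linear A -> tens comma_H B};
  comma_circ : forall x, comma_phi x \in circ comma_H B;
  comma_homog : forall n x, qcomp A n x ->
    comma_phi x \in tsub (qcomp comma_H n) (qcomp B n)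
}.

Record comma_arrow (X Y : comma) := CommaArrow {
  comma_fun :> qmorph (comma_H X) (comma_H Y);
  comma_comm : forall x : A,
    comma_phi Y x = tmap (qmorph_fun comma_fun) idfun (comma_phi X x)
}.

Variables (n m : nat) (a : 'I_n -> qgenT A) (b : 'I_m -> qgenT B).
Variable b' : 'I_m -> dual (qgenT B).

Local Notation A1 := (qgenT A).
Local Notation B1 := (qgenT B).
Local Notation BA := (tens (dual B1) A1).

Variable tauhat : {linear tens B1 BA -> tens B1 BA}.

Section Member.
Variables (X : comma) (h : 'I_n -> 'I_m -> comma_H X).

Definition is_coef : Prop := forall i,
  comma_phi X (subsp_val (a i)) = \sum_j h i j ⊗ subsp_val (b j).

Definition Hphi : qspace K :=
  gen_qspace (allpairs h (enum 'I_n) (enum 'I_m)).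

Definition Hphi_val : {linear Hphi -> comma_H X} := subal_val.

Definition is_pi (pi : {linear BA -> qgenT Hphi}) : Prop :=
  forall i j, Hphi_val (subsp_val (pi (b' j ⊗ a i))) = h i j.
End Member.

(* The data h, pi, tauhat_phi, tau and psi are each determined by phi and     *)
(* tauhat: b is a basis of B_1, pi is surjective, and B and H^phi are         *)
(* generated by B_1 and H_1^phi. The map psi is phi corestricted along the    *)
(* inclusion of H^phi (x) B in H (x) B.                                       *)
Definition Upsilon (X : comma) : Prop :=
  exists h : 'I_n -> 'I_m -> comma_H X, is_coef h /\
  exists pi : {linear BA -> qgenT (Hphi h)}, is_pi pi /\
  exists tauhat_phi :
    {linear tens B1 (qgenT (Hphi h)) -> tens B1 (qgenT (Hphi h))},
    (forall x, tauhat_phi (tmap idfun pi x) = tmap idfun pi (tauhat x)) /\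
  exists tau : {linear tens B (Hphi h) -> tens (Hphi h) B},
    [/\ twisting tau,
        symmetric_twist tau,
        forall x, tau (tmap subsp_val subsp_val x) =
          tmap subsp_val subsp_val (tflip (tauhat_phi x)) &
        exists psi : {linear A -> tens (Hphi h) B}, circ_morph tau psi /\
          forall x, comma_phi X x = tmap (Hphi_val h) idfun (psi x)].

(* The full subcategory of the comma category cut out by P has an initial     *)
(* object; arrows are compared as functions.                                  *)
Definition has_initial (P : comma -> Prop) : Prop :=
  exists X, P X /\ forall Y, P Y ->
    exists f : comma_arrow X Y, forall g : comma_arrow X Y, g =1 f.

End CommaCategory.

(* Main.v *)
From HB Require Import structures.
From mathcomp Require Import all_boot all_algebra sesquilinear.
From mathcomp Require Import generic_quotient.
From mathcomp Require Import boolp classical_sets functions.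
From mathcomp Require Import reals complex.
Require Import Defs.

(** The initial object is carried by the largest quotient of the tensor algebra
    of W := B_1^* (x) A_1 on which the defining conditions of the category hold.

    Call a model an algebra P with a linear map W -> P, an injective twisting
    map B (x) P -> P (x) B restricting to the flip of tauhat, and an algebra map
    psi from A to the twisted tensor product with psi(a_i) the canonical
    element sum_j (b^j (x) a_i) (x) b_j, such that P embeds in a conic space
    with W landing in degree 1. Every object of the category yields a model on
    H^phi (model_of_Upsilon). The ground field with the flip is a model too
    (trivial_model): A maps to it by its augmentation.

    Let H be generated by W in the product of all models, that is, the algebra
    expressions in W up to equality in every model (jalg, universal_qspace).
    The evaluations e_M of H in the models M are jointly injective, and
    over a field so are the maps e_M (x) id on H (x) B (tmap_joint_inj: if
    t = sum_k v_k (x) w_k with the w_k independent, functionals dual to the w_k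
    show that e_M (v_k) = 0). The elements of B (x) H and A whose images under
    the twisting maps and the maps psi of all models lift simultaneously to
    H (x) B are closed under the algebra operations and contain the generators,
    hence a twisting map tau and a map psi exist on H (exists_tau, exists_psi),
    and they inherit all identities by joint injectivity. The map tau is
    injective because it is so in every model, and surjective because tauhat
    is surjective and the hexagon identities propagate surjectivity from
    generators to products (lift_tau_bij). Since tau maps B_1 (x) H_n to
    H_n (x) B_1, the map psi is homogeneous (lift_psi_homog); H is conic because
    a relation in H is homogeneous component by component in every model
    (conic_joint).

    The arrow from this object to another one is the evaluation at the
    corresponding model. It is unique because the components of phi(a_i) on
    the b_j generate H and can be read off with functionals on B extending the
    b^j (coord_uniq). *)

Set Implicit Arguments.
Unset Strict Implicit.
Unset Printing Implicit Defensive.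

Import GRing.Theory.
Local Open Scope ring_scope.
Local Open Scope complex_scope.
Local Open Scope quotient_scope.
Local Open Scope classical_set_scope.

(** * Induction principles and linear algebra of tensor products *)

Lemma span_ind (K : fieldType) (V : lmodType K) (X : set V) (S : V -> Prop) :
  (forall x, X x -> S x) -> S 0 ->
  (forall c x y, S x -> S y -> S (c *: x + y)) ->
  forall x, x \in span X -> S x.
Proof.
move=> SX S0 Slin x.
pose P : {pred V} := [pred y | `[< S y >]].
have Pc : subsemimod_closed P.
  split; first split=> [|u v /asboolP Su /asboolP Sv]; last 1 first.
  - move=> c u /asboolP Su; apply/asboolP.
    by rewrite -[c *: u]addr0; apply: Slin.
  - exact/asboolP.
  - by apply/asboolP; rewrite -[u]scale1r; apply: Slin.
pose Pm := GRing.isSubSemiModClosed.Build K V P Pc.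
pose P' : submodClosed V := HB.pack P Pm.
move=> /(@span_min K V X P') -/(_ _)/asboolP; apply.
by move=> y Xy; apply/asboolP/SX.
Qed.

Lemma subalg_gen_ind (K : fieldType) (A : algType K) (X : set A)
    (S : A -> Prop) :
  (forall x, X x -> S x) -> S 1 ->
  (forall c x y, S x -> S y -> S (c *: x + y)) ->
  (forall x y, S x -> S y -> S (x * y)) ->
  forall x, x \in subalg_gen X -> S x.
Proof.
move=> SX S1 Slin Smul x.
pose P : {pred A} := [pred y | `[< S y >]].
have S0 : S 0 by rewrite -(subrr 1) -scaleN1r addrC; apply: Slin.
have Pc : GRing.subsemialg_closed P.
  split=> [|||u v /asboolP Su /asboolP Sv].
  - exact/asboolP.
  - split=> [|u v /asboolP Su /asboolP Sv]; first exact/asboolP.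
    by apply/asboolP; rewrite -[u]scale1r; apply: Slin.
  - move=> c u /asboolP Su; apply/asboolP.
    by rewrite -[c *: u]addr0; apply: Slin.
  - by apply/asboolP/Smul.
pose Pm := GRing.isSubSemiAlgClosed.Build K A P Pc.
pose P' : subalgClosed A := HB.pack P Pm.
move=> /(@subalg_gen_min K A X P') -/(_ _)/asboolP; apply.
by move=> y Xy; apply/asboolP/SX.
Qed.

Lemma qspace_ind (K : fieldType) (A : qspace K) (S : A -> Prop) :
  (forall x, x \in qgen A -> S x) -> S 1 ->
  (forall c x y, S x -> S y -> S (c *: x + y)) ->
  (forall x y, S x -> S y -> S (x * y)) ->
  forall x, S x.
Proof.
move=> SX S1 Sl Sm x; apply: (@subalg_gen_ind _ _ [set` qgen A]) => //.
by rewrite qgen_gen.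
Qed.

Lemma tens_ind (K : fieldType) (V W : lmodType K) (S : tens V W -> Prop) :
  (forall v w, S (v ⊗ w)) -> (forall x y, S x -> S y -> S (x + y)) ->
  forall x, S x.
Proof.
move=> St Sa x; have [s ->] := tens_sumE x.
have S0 : S 0 by have := St 0 0; rewrite linear0l.
exact: big_ind.
Qed.

(** A single-valued total linear relation is the graph of a linear map. *)
Lemma linear_of_rel (K : fieldType) (U V : lmodType K) (R : U -> V -> Prop) :
  (forall u, exists v, R u v) ->
  (forall u v w, R u v -> R u w -> v = w) ->
  (forall c u u' v v', R u v -> R u' v' -> R (c *: u + u') (c *: v + v')) ->
  exists f : {linear U -> V}, forall u, R u (f u).
Proof.
move=> tot uniq lin; have [f fP] := choice tot.
have fl : linear f by move=> c x y; apply: uniq (fP _) _; apply: lin.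
pose Fm := GRing.isLinear.Build K U V *:%R f fl.
by pose f' : {linear U -> V} := HB.pack f Fm; exists f'.
Qed.

(** A pointwise lifting of linear maps along a jointly injective family of
    linear maps is linear. *)
Lemma joint_lift (K : fieldType) (U V : lmodType K) (I : Type)
    (V_ : I -> lmodType K) (e : forall i, {linear V -> V_ i})
    (g : forall i, {linear U -> V_ i}) :
  (forall v, (forall i, e i v = 0) -> v = 0) ->
  (forall u, exists v, forall i, e i v = g i u) ->
  exists f : {linear U -> V}, forall i u, e i (f u) = g i u.
Proof.
move=> einj ex.
have [||f fP] := linear_of_rel ex; last by exists f => i u; exact: fP.
  move=> u v w ev ew; apply/subr0_eq/einj => i.
  by rewrite raddfB /= ev ew subrr.
by move=> c u u' v v' ev ev' i; rewrite !linearP ev ev'.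
Qed.

(** A vector outside a subspace is separated from it by a linear functional:
    a subspace that is maximal among those avoiding the vector is a
    hyperplane. *)
Lemma sep_functional (K : fieldType) (W : lmodType K) (U : submodClosed W)
    (w : W) : w \notin U ->
  exists f : {linear W -> K^o}, f w = 1 /\ forall u, u \in U -> f u = 0.
Proof.
move=> wU.
(* The condition is vacuous for the empty set, as the union of the empty
   chain must satisfy it. *)
pose P (M : set W) := [/\ forall c x y, M x -> M y -> M (c *: x + y),
  forall x u, M x -> u \in U -> M (x + u) & ~ M w].
have PF (F : set (set W)) : F `<=` P -> total_on F subset ->
    P (\bigcup_(X in F) X).
  move=> FP tot; split.
  - move=> c x y [X FX Xx] [Y FY Yy].
    have [XY|YX] := tot _ _ FX FY.
      by exists Y => //; have [+ _ _] := FP _ FY; apply=> //; apply: XY.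
    by exists X => //; have [+ _ _] := FP _ FX; apply=> //; apply: YX.
  - move=> x u [X FX Xx] Uu; exists X => //.
    by have [_ + _] := FP _ FX; apply.
  - by move=> [X FX Xw]; have [_ _] := FP _ FX; apply.
have [M [[Mlin MU Mw] Mmax]] := Zorn_bigcup PF.
have M0 : M 0.
  apply: contrapT => M0; apply: (Mmax [set` U]); last first.
    split=> [c x y /= Ux Uy|x u /= Ux Uu|].
    - by apply: rpredD => //; apply: rpredZ.
    - exact: rpredD.
    - exact/negP.
  split=> [x Mx|sub].
    by case: M0; rewrite -[0](subrr x) -scaleN1r addrC; apply: Mlin.
  by apply/M0/sub; exact: rpred0.
have MUs u : u \in U -> M u by move=> Uu; rewrite -[u]add0r; apply: MU.
have MZ c x : M x -> M (c *: x).
  by move=> Mx; rewrite -[_ *: _]addr0; apply: Mlin.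
have uniqc (u : W) (c d : K) : M (u - c *: w) -> M (u - d *: w) -> c = d.
  move=> Mc Md; apply/eqP; rewrite -subr_eq0; apply/negPn/negP => cd.
  apply: Mw; suff : M ((c - d) *: w).
    by move/(MZ (c - d)^-1); rewrite scalerA mulVf // scale1r.
  have := Mlin (- 1) _ _ Mc Md; rewrite scaleN1r opprB addrA subrK.
  by rewrite scalerBl.
have [|||f fP] := @linear_of_rel K W K^o (fun v c => M (v - (c : K) *: w)).
- move=> v; apply: contrapT => nv.
  have Mv : ~ M v by move=> Mv; apply: nv; exists 0; rewrite scale0r subr0.
  apply: (Mmax [set y | exists2 x, M x & exists d : K, y = x + d *: v]).
    split=> [x Mx|sub].
      by exists x => //; exists 0; rewrite scale0r addr0.
    by apply/Mv/sub; exists 0 => //; exists 1; rewrite scale1r add0r.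
  split.
  - move=> c _ _ [x Mx [d ->]] [y My [d' ->]].
    exists (c *: x + y); first exact: Mlin.
    by exists (c * d + d'); rewrite scalerDr scalerDl scalerA addrACA.
  - move=> _ u [x Mx [d ->]] Uu; exists (x + u); first exact: MU.
    by exists d; rewrite addrAC.
  - move=> [x Mx [d wE]].
    have d0 : d != 0.
      by apply/eqP => d0; apply: Mw; rewrite wE d0 scale0r addr0.
    apply: nv; exists d^-1.
    rewrite wE scalerDr scalerA mulVf // scale1r opprD addrCA subrr addr0.
    by rewrite -scaleNr; apply: MZ.
- by move=> u c d; apply: uniqc.
- move=> c u u' d d' Md Md'; have := Mlin c _ _ Md Md'.
  by rewrite scalerBr addrACA -opprD scalerA -scalerDl.
exists f; split=> [|u Uu].
  by apply: uniqc (fP w) _; rewrite scale1r subrr.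
by apply: uniqc (fP u) _; rewrite scale0r subr0; apply: MUs.
Qed.

(** A linear functional extends along an injective linear map. *)
Lemma extend_functional (K : fieldType) (V W : lmodType K)
    (f : {linear V -> W}) (g : {linear V -> K^o}) :
  injective f -> exists g' : {linear W -> K^o}, forall v, g' (f v) = g v.
Proof.
move=> finj.
case: (pselect (exists v, g v != 0)) => [[v gv]|g0]; last first.
  exists (\0 : {linear W -> K^o}) => v /=; apply/esym/eqP/negPn/negP => gv.
  by apply: g0; exists v.
have [v0 gv0] : exists v0, g v0 = 1.
  by exists ((g v)^-1 *: v); rewrite linearZ /= [LHS]mulVf.
pose N : {pred V} := [pred x | g x == 0].
have Nc : subsemimod_closed N.
  split; first split=> [|x y /eqP gx /eqP gy]; last 1 first.
  - by move=> c x /eqP gx; rewrite inE /= linearZ /= gx scaler0.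
  - by rewrite inE /= raddf0.
  - by rewrite inE /= raddfD /= gx gy addr0.
pose Nm := GRing.isSubSemiModClosed.Build K V N Nc.
pose N' : submodClosed V := HB.pack N Nm.
have [|h [h1 hN]] := @sep_functional K W (lin_img f N') (f v0).
  apply/negP => /asboolP[x /eqP xN /finj xv].
  by move: gv0; rewrite -xv xN => /esym/eqP; rewrite oner_eq0.
exists h => x.
have hf : h (f (x - g x *: v0)) = 0.
  apply/hN/asboolP; exists (x - g x *: v0) => //; apply/eqP.
  by rewrite raddfB /= linearZ /= gv0 [_ *: 1]mulr1 subrr.
have -> : f x = g x *: f v0 + f (x - g x *: v0).
  by rewrite -linearZ -raddfD addrC subrK.
by rewrite raddfD /= hf addr0 linearZ /= h1 [LHS]mulr1.
Qed.

Section Contraction.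
Variables (K : fieldType) (V W : lmodType K) (f : {linear W -> K^o}).

Definition contr_fun (v : V) (w : W) : V := (f w : K) *: v.

Lemma contr_bilinear : bilinear_for *:%R *:%R contr_fun.
Proof.
split=> [w|v] c x y /=; rewrite /contr_fun.
  by rewrite scalerDr !scalerA mulrC.
by rewrite linearP /= scalerDl scalerA.
Qed.

HB.instance Definition _ :=
  bilinear_isBilinear.Build K V W V *:%R *:%R contr_fun contr_bilinear.

(** The contraction of the second tensor factor with a linear functional. *)
Definition contr : {linear tens V W -> V} := tlift contr_fun.

Lemma contrE v w : contr (v ⊗ w) = (f w : K) *: v.
Proof. exact: tliftE. Qed.
End Contraction.

Arguments contr {K V W} f.

Lemma contr_tmap (K : fieldType) (V V' W : lmodType K) (e : {linear V -> V'})
    (f : {linear W -> K^o}) (t : tens V W) :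
  contr f (tmap e idfun t) = e (contr f t).
Proof.
elim/tens_ind: t => [v w|x y xE yE]; first by rewrite tmapE !contrE linearZ.
by rewrite !raddfD /= xE yE.
Qed.

(** A summand whose second factor depends linearly on those of the other
    summands can be absorbed by them. *)
Lemma tens_absorb (K : fieldType) (V W : lmodType K) (s : seq (V * W))
    (v : V) (w : W) : w \in span [set` map snd s] ->
  exists2 s' : seq (V * W), size s' = size s &
    \sum_(p <- s') p.1 ⊗ p.2 = v ⊗ w + \sum_(p <- s) p.1 ⊗ p.2.
Proof.
move=> ws; suff [s' ss' sE] : exists2 s' : seq (V * W), map snd s' = map snd s &
    \sum_(p <- s') p.1 ⊗ p.2 = v ⊗ w + \sum_(p <- s) p.1 ⊗ p.2.
  by exists s' => //; rewrite -(size_map snd) ss' size_map.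
have : forall v t, map snd t = map snd s ->
    exists2 s' : seq (V * W), map snd s' = map snd s &
    \sum_(p <- s') p.1 ⊗ p.2 = v ⊗ w + \sum_(p <- t) p.1 ⊗ p.2.
  elim/span_ind: ws => [{}w /= + {}v t ts|{}v t ts|c x y Sx Sy {}v t ts].
  - rewrite -{}ts; elim: t => //= -[u w0] t IH; rewrite inE => /predU1P[->|].
      exists ((v + u, w0) :: t) => //.
      by rewrite !big_cons /= linearDl addrA.
    move=> /IH[t' tt' tE]; exists ((u, w0) :: t'); first by rewrite /= tt'.
    by rewrite !big_cons tE addrCA.
  - by exists t => //; rewrite linear0r add0r.
  - have [t1 t1s t1E] := Sy v t ts; have [t2 t2s t2E] := Sx (c *: v) _ t1s.
    exists t2 => //; rewrite t2E t1E linearPr addrA.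
    by rewrite linearZl_LR.
by apply.
Qed.

(** Over a field, tensoring with a fixed space preserves the joint
    injectivity of any family of linear maps. *)
Lemma tmap_joint_inj (K : fieldType) (V W : lmodType K) (I : Type)
    (V_ : I -> lmodType K) (e : forall i, {linear V -> V_ i}) :
  (forall v, (forall i, e i v = 0) -> v = 0) ->
  forall t : tens V W, (forall i, tmap (e i) idfun t = 0) -> t = 0.
Proof.
move=> einj t; have [s ->] := tens_sumE t.
have [n] := ubnP (size s); elim: n s => // n IH [|[v w] s] /=.
  by move=> _ _; rewrite big_nil.
rewrite ltnS big_cons /= => sn tE.
have [ws|/negP/negP/sep_functional[f [fw fs]]] :=
  boolP (w \in span [set` map snd s]).
  have [s' ss' sE] := tens_absorb v ws; rewrite -sE; apply: IH => [|i].
    by rewrite ss'.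
  by rewrite sE; exact: tE.
have fsum : contr f (\sum_(p <- s) p.1 ⊗ p.2) = 0 :> V.
  rewrite linear_sum big_seq big1 //= => p ps; rewrite contrE fs ?scale0r //.
  by apply: sub_span; apply/mapP; exists p.
have v0 : v = 0.
  apply: einj => i; have := congr1 (contr f) (tE i).
  by rewrite contr_tmap raddfD /= fsum addr0 contrE fw scale1r raddf0.
by move: tE; rewrite v0 linear0l add0r => tE; apply: IH tE.
Qed.

Lemma tflipK (K : fieldType) (V W : lmodType K) (t : tens V W) :
  tflip (tflip t) = t.
Proof.
elim/tens_ind: t => [v w|x y xE yE]; first by rewrite !tflipE.
by rewrite !raddfD /= xE yE.
Qed.

Lemma tflip_tmap (K : fieldType) (V V' W W' : lmodType K)
    (f : {linear V -> V'}) (g : {linear W -> W'}) (t : tens V W) :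
  tflip (tmap f g t) = tmap g f (tflip t).
Proof.
elim/tens_ind: t => [v w|x y xE yE]; first by rewrite tmapE !tflipE tmapE.
by rewrite !raddfD /= xE yE.
Qed.

Lemma tmap_joint_injr (K : fieldType) (V W : lmodType K) (I : Type)
    (V_ : I -> lmodType K) (e : forall i, {linear V -> V_ i}) :
  (forall v, (forall i, e i v = 0) -> v = 0) ->
  forall t : tens W V, (forall i, tmap idfun (e i) t = 0) -> t = 0.
Proof.
move=> einj t tE; rewrite -[t]tflipK; apply/eqP; rewrite raddf_eq0; last first.
  exact: (can_inj (@tflipK _ _ _)).
apply/eqP/(tmap_joint_inj einj) => i.
by rewrite -tflip_tmap tE raddf0.
Qed.

Lemma tmap_comp (K : fieldType) (V1 V2 V3 W1 W2 W3 : lmodType K)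
    (f : {linear V1 -> V2}) (f' : {linear V2 -> V3}) (h : {linear V1 -> V3})
    (g : {linear W1 -> W2}) (g' : {linear W2 -> W3}) (k : {linear W1 -> W3})
    (t : tens V1 W1) :
  (forall v, f' (f v) = h v) -> (forall w, g' (g w) = k w) ->
  tmap f' g' (tmap f g t) = tmap h k t.
Proof.
move=> fh gk; elim/tens_ind: t => [v w|x y xE yE].
  by rewrite !tmapE fh gk.
by rewrite !raddfD /= xE yE.
Qed.

Lemma tmap_square (K : fieldType) (V1 V2 V2' V3 W1 W2 W2' W3 : lmodType K)
    (f : {linear V1 -> V2}) (f' : {linear V2 -> V3})
    (h : {linear V1 -> V2'}) (h' : {linear V2' -> V3})
    (g : {linear W1 -> W2}) (g' : {linear W2 -> W3})
    (k : {linear W1 -> W2'}) (k' : {linear W2' -> W3}) (t : tens V1 W1) :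
  (forall v, f' (f v) = h' (h v)) -> (forall w, g' (g w) = k' (k w)) ->
  tmap f' g' (tmap f g t) = tmap h' k' (tmap h k t).
Proof.
move=> fh gk; elim/tens_ind: t => [v w|x y xE yE].
  by rewrite !tmapE fh gk.
by rewrite !raddfD /= xE yE.
Qed.

(** Over a field, the tensor product of injective linear maps is
    injective. *)
Lemma tmap_inj (K : fieldType) (V V' W W' : lmodType K)
    (f : {linear V -> V'}) (g : {linear W -> W'}) :
  injective f -> injective g -> injective (tmap f g).
Proof.
move=> finj ginj; apply: raddf_inj => t tE.
have e1 : forall v, (forall i : unit, f v = 0) -> v = 0.
  by move=> v /(_ tt) fv; apply: finj; rewrite fv raddf0.
have e2 : forall v, (forall i : unit, g v = 0) -> v = 0.
  by move=> v /(_ tt) fv; apply: ginj; rewrite fv raddf0.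
apply: (tmap_joint_inj e1) => _; apply: (tmap_joint_injr e2) => _.
by rewrite -[RHS]tE; apply: tmap_comp.
Qed.

(** * The algebra generated by a joint family of linear maps *)

(** Formal algebra expressions in the vectors of W. *)
Inductive aexpr (K : fieldType) (W : lmodType K) : Type :=
| AVar of W
| AOne
| AAdd of aexpr W & aexpr W
| AMul of aexpr W & aexpr W
| AScale of K & aexpr W.

Arguments AOne {K W}.

HB.instance Definition _ (K : fieldType) (W : lmodType K) :=
  gen_eqMixin (aexpr W).
HB.instance Definition _ (K : fieldType) (W : lmodType K) :=
  gen_choiceMixin (aexpr W).

Section JointAlgebra.
Variables (K : fieldType) (W : lmodType K) (I : Type) (i0 : I).
Variables (P : I -> algType K) (f : forall i, {linear W -> P i}).

Fixpoint aeval i (t : aexpr W) : P i :=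
  match t with
  | AVar w => f i w
  | AOne => 1
  | AAdd t u => aeval i t + aeval i u
  | AMul t u => aeval i t * aeval i u
  | AScale c t => c *: aeval i t
  end.

Definition jalg_rel : rel (aexpr W) := fun t u =>
  `[< forall i, aeval i t = aeval i u >].

Lemma jalg_rel_refl : reflexive jalg_rel.
Proof. by move=> t; apply/asboolP. Qed.

Lemma jalg_rel_sym : symmetric jalg_rel.
Proof. by move=> t u; apply/asboolP/asboolP => tu i; rewrite tu. Qed.

Lemma jalg_rel_trans : transitive jalg_rel.
Proof.
by move=> t s u /asboolP st /asboolP tu; apply/asboolP => i; rewrite st.
Qed.

Canonical jalg_equiv := EquivRel jalg_rel jalg_rel_refl jalg_rel_sym
  jalg_rel_trans.

(** The subalgebra generated by W in the product of the P i, that is, the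
    algebra expressions in W up to equality of all their values. Expressions
    are used because the index type I may be too large for the product to be
    an algebra in the same universe. The argument i0 only witnesses that I is
    inhabited, so that the algebra is nonzero. *)
Definition jalg of I : Type := {eq_quot jalg_equiv}.
Local Notation Q := (jalg i0).

HB.instance Definition _ := Choice.on Q.
HB.instance Definition _ := Quotient.on Q.
HB.instance Definition _ := EqQuotient.on Q.

Definition jeval_fun i (x : Q) : P i := aeval i (repr x).

Lemma jevalE i t : jeval_fun i (\pi_Q t) = aeval i t.
Proof.
have /eqmodP/asboolP : repr (\pi_Q t) = t %[mod Q] by rewrite reprK.
exact.
Qed.

Lemma jeval_inj (x y : Q) : (forall i, jeval_fun i x = jeval_fun i y) -> x = y.
Proof.
by move=> xy; rewrite -[x]reprK -[y]reprK; apply/eqmodP/asboolP.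
Qed.

Definition jadd (x y : Q) : Q := \pi_Q (AAdd (repr x) (repr y)).
Definition jmul (x y : Q) : Q := \pi_Q (AMul (repr x) (repr y)).
Definition jscale (c : K) (x : Q) : Q := \pi_Q (AScale c (repr x)).
Definition jone : Q := \pi_Q AOne.
Definition jzero : Q := jscale 0 jone.
Definition jopp (x : Q) : Q := jscale (- 1) x.
Definition jvar_fun (w : W) : Q := \pi_Q (AVar w).

Lemma jevalD i x y : jeval_fun i (jadd x y) = jeval_fun i x + jeval_fun i y.
Proof. by rewrite jevalE. Qed.
Lemma jevalM i x y : jeval_fun i (jmul x y) = jeval_fun i x * jeval_fun i y.
Proof. by rewrite jevalE. Qed.
Lemma jevalZ i c x : jeval_fun i (jscale c x) = c *: jeval_fun i x.
Proof. by rewrite jevalE. Qed.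
Lemma jeval1 i : jeval_fun i jone = 1.
Proof. by rewrite jevalE. Qed.
Lemma jeval0 i : jeval_fun i jzero = 0.
Proof. by rewrite jevalZ scale0r. Qed.
Lemma jevalN i x : jeval_fun i (jopp x) = - jeval_fun i x.
Proof. by rewrite jevalZ scaleN1r. Qed.
Lemma jeval_var i w : jeval_fun i (jvar_fun w) = f i w.
Proof. by rewrite jevalE. Qed.

Let jE := (jevalD, jevalM, jevalZ, jeval1, jeval0, jevalN).

Lemma jaddA : associative jadd.
Proof. by move=> x y z; apply: jeval_inj => i; rewrite !jE addrA. Qed.
Lemma jaddC : commutative jadd.
Proof. by move=> x y; apply: jeval_inj => i; rewrite !jE addrC. Qed.
Lemma jadd0 : left_id jzero jadd.
Proof. by move=> x; apply: jeval_inj => i; rewrite !jE add0r. Qed.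
Lemma jaddN : left_inverse jzero jopp jadd.
Proof. by move=> x; apply: jeval_inj => i; rewrite !jE addNr. Qed.

HB.instance Definition _ :=
  GRing.isZmodule.Build Q jaddA jaddC jadd0 jaddN.

Lemma jmulA : associative jmul.
Proof. by move=> x y z; apply: jeval_inj => i; rewrite !jE mulrA. Qed.
Lemma jmul1 : left_id jone jmul.
Proof. by move=> x; apply: jeval_inj => i; rewrite !jE mul1r. Qed.
Lemma jmul1r : right_id jone jmul.
Proof. by move=> x; apply: jeval_inj => i; rewrite !jE mulr1. Qed.
Lemma jmulDl : left_distributive jmul +%R.
Proof. by move=> x y z; apply: jeval_inj => i; rewrite !jE mulrDl. Qed.
Lemma jmulDr : right_distributive jmul +%R.
Proof. by move=> x y z; apply: jeval_inj => i; rewrite !jE mulrDr. Qed.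
Lemma jone_neq0 : jone != 0.
Proof.
apply/eqP => /(congr1 (jeval_fun i0)); rewrite jeval1 [RHS]jeval0.
by move/eqP; rewrite oner_eq0.
Qed.

HB.instance Definition _ := GRing.Zmodule_isNzRing.Build Q
  jmulA jmul1 jmul1r jmulDl jmulDr jone_neq0.

Lemma jscaleA c d (x : Q) : jscale c (jscale d x) = jscale (c * d) x.
Proof. by apply: jeval_inj => i; rewrite !jE scalerA. Qed.
Lemma jscale1 : left_id 1 jscale.
Proof. by move=> x; apply: jeval_inj => i; rewrite !jE scale1r. Qed.
Lemma jscaleDr : right_distributive jscale +%R.
Proof. by move=> c x y; apply: jeval_inj => i; rewrite !jE scalerDr. Qed.
Lemma jscaleDl x : {morph jscale^~ x : c d / c + d}.
Proof. by move=> c d; apply: jeval_inj => i; rewrite !jE scalerDl. Qed.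

HB.instance Definition _ := GRing.Zmodule_isLmodule.Build K Q
  jscaleA jscale1 jscaleDr jscaleDl.

Lemma jscaleAl c (x y : Q) : c *: (x * y) = (c *: x) * y.
Proof. by apply: jeval_inj => i; rewrite !jE scalerAl. Qed.
HB.instance Definition _ := GRing.Lmodule_isLalgebra.Build K Q jscaleAl.

Lemma jscaleAr c (x y : Q) : c *: (x * y) = x * (c *: y).
Proof. by apply: jeval_inj => i; rewrite !jE scalerAr. Qed.
HB.instance Definition _ := GRing.Lalgebra_isAlgebra.Build K Q jscaleAr.

Lemma jeval_linear i : linear (jeval_fun i).
Proof. by move=> c x y; rewrite !jE. Qed.
HB.instance Definition _ i :=
  GRing.isLinear.Build K Q (P i) *:%R (jeval_fun i) (jeval_linear i).

Lemma jeval_monoid i : monoid_morphism (jeval_fun i).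
Proof. by split=> [|x y]; rewrite !jE. Qed.
HB.instance Definition _ i :=
  GRing.isMonoidMorphism.Build Q (P i) (jeval_fun i) (jeval_monoid i).

Definition jeval i : {lrmorphism Q -> P i} := jeval_fun i.

Lemma jvar_linear : linear jvar_fun.
Proof.
by move=> c x y; apply: jeval_inj => i; rewrite !jE !jeval_var linearP.
Qed.
HB.instance Definition _ :=
  GRing.isLinear.Build K W Q *:%R jvar_fun jvar_linear.

Definition jvar : {linear W -> Q} := jvar_fun.
End JointAlgebra.

(** * Twisting maps on pure tensors *)

Section Mulmaps.
Variables (K : fieldType) (A : algType K) (a : A).

Definition lmul_fun (x : A) : A := a * x.
Lemma lmul_linear : linear lmul_fun.
Proof. by move=> c x y; rewrite /lmul_fun mulrDr scalerAr. Qed.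
HB.instance Definition _ :=
  GRing.isLinear.Build K A A *:%R lmul_fun lmul_linear.
Definition lmul : {linear A -> A} := lmul_fun.

Definition rmul_fun (x : A) : A := x * a.
Lemma rmul_linear : linear rmul_fun.
Proof. by move=> c x y; rewrite /rmul_fun mulrDl scalerAl. Qed.
HB.instance Definition _ :=
  GRing.isLinear.Build K A A *:%R rmul_fun rmul_linear.
Definition rmul : {linear A -> A} := rmul_fun.

Lemma lmulE x : lmul x = a * x. Proof. by []. Qed.
Lemma rmulE x : rmul x = x * a. Proof. by []. Qed.
End Mulmaps.

Section Steps.
Variables (K : fieldType) (H B : algType K).
Variable tau : {linear tens B H -> tens H B}.

(** The right action on H (x) B through which a twisting map computes
    tau (y (x) (h * h')) from tau (y (x) h): it sends h (x) y to
    h tau (y (x) h'). *)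
Definition stepH (h' : H) (t : tens H B) : tens H B :=
  tmap tmul idfun (tassocV (tmap idfun tau (tassoc (t ⊗ h')))).

(** The left action on H (x) B through which a twisting map computes
    tau ((y * y') (x) h) from tau (y' (x) h): it sends h (x) y' to
    tau (y (x) h) y'. *)
Definition stepB (y : B) (t : tens H B) : tens H B :=
  tmap idfun tmul (tassoc (tmap tau idfun (tassocV (y ⊗ t)))).

Lemma stepH_linear h' : linear (stepH h').
Proof. by move=> c x y; rewrite /stepH linearPl !linearP. Qed.
HB.instance Definition _ h' :=
  GRing.isLinear.Build K (tens H B) (tens H B) *:%R (stepH h')
    (stepH_linear h').

Lemma stepB_linear y : linear (stepB y).
Proof. by move=> c x z; rewrite /stepB linearPr !linearP. Qed.
HB.instance Definition _ y :=
  GRing.isLinear.Build K (tens H B) (tens H B) *:%R (stepB y)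
    (stepB_linear y).

Lemma stepHE h' h y :
  stepH h' (h ⊗ y) = tmap (lmul h) idfun (tau (y ⊗ h')).
Proof.
rewrite /stepH tassocE tmapE.
elim/tens_ind: (tau _) => [u v|u v uE vE] /=.
  by rewrite tassocVE !tmapE tmulE.
by rewrite linearDr !raddfD /= uE vE.
Qed.

Lemma stepBE y h y' :
  stepB y (h ⊗ y') = tmap idfun (rmul y') (tau (y ⊗ h)).
Proof.
rewrite /stepB tassocVE tmapE.
elim/tens_ind: (tau _) => [u v|u v uE vE] /=.
  by rewrite tassocE !tmapE tmulE.
by rewrite linearDl !raddfD /= uE vE.
Qed.

Lemma twist_mul_pureE h y h' y' :
  twist_mul tau (h ⊗ y) (h' ⊗ y') = tmap (lmul h) (rmul y') (tau (y ⊗ h')).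
Proof.
rewrite twist_mulE; elim/tens_ind: (tau _) => [u v|u v uE vE] /=.
  by rewrite tmapE tassocE tassocVE !tmapE !tmulE.
by rewrite linearDl linearDr !raddfD /= uE vE.
Qed.

Lemma twist_mul_linearl t : linear ((twist_mul tau)^~ t).
Proof. by move=> c x y; rewrite /twist_mul linearPl !linearP. Qed.

Lemma twist_mul_linearr t : linear (twist_mul tau t).
Proof. by move=> c x y; rewrite /twist_mul linearPr !linearP. Qed.

Lemma twist_mul_bilinear : bilinear_for *:%R *:%R (twist_mul tau).
Proof.
by split=> [w|v] c x y /=; [apply: twist_mul_linearl|apply: twist_mul_linearr].
Qed.
HB.instance Definition _ := bilinear_isBilinear.Build K (tens H B) (tens H B)
  (tens H B) *:%R *:%R (twist_mul tau) twist_mul_bilinear.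

Lemma twisting_mulHE : twisting tau -> forall y h h',
  tau (y ⊗ (h * h')) = stepH h' (tau (y ⊗ h)).
Proof.
move=> tw y h h'; have := twisting_mulH tw (y ⊗ (h ⊗ h')).
by rewrite tmapE tmulE tassocVE tmapE.
Qed.

Lemma twisting_mulBE : twisting tau -> forall y y' h,
  tau ((y * y') ⊗ h) = stepB y (tau (y' ⊗ h)).
Proof.
move=> tw y y' h; have := twisting_mulB tw (y ⊗ y' ⊗ h).
by rewrite tmapE tmulE tassocE tmapE.
Qed.

(** The hexagon identities of a twisting map need only be checked on pure
    tensors. *)
Lemma twisting_pure :
  (forall y h h', tau (y ⊗ (h * h')) = stepH h' (tau (y ⊗ h))) ->
  (forall y y' h, tau ((y * y') ⊗ h) = stepB y (tau (y' ⊗ h))) ->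
  (forall y, tau (y ⊗ 1) = 1 ⊗ y) -> (forall h, tau (1 ⊗ h) = h ⊗ 1) ->
  twisting tau.
Proof.
move=> tH tB t1 t1'; split=> // x.
  elim/tens_ind: x => [t h|t u tE uE]; last by rewrite !raddfD /= tE uE.
  elim/tens_ind: t => [y y'|t u tE uE].
    by rewrite tassocE !tmapE tmulE tB.
  by rewrite linearDl !raddfD /= tE uE.
elim/tens_ind: x => [y t|t u tE uE]; last by rewrite !raddfD /= tE uE.
elim/tens_ind: t => [h h'|t u tE uE].
  by rewrite tassocVE !tmapE tmulE tH.
by rewrite linearDr !raddfD /= tE uE.
Qed.
End Steps.

Lemma flip_twisting (K : fieldType) (H B : algType K) :
  twisting (@tflip K B H).
Proof.
apply: twisting_pure => [y h h'|y y' h|y|h]; rewrite ?tflipE //.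
  by rewrite stepHE tflipE tmapE.
by rewrite stepBE tflipE tmapE.
Qed.

Section Naturality.
Variables (K : fieldType) (H H' B : algType K) (e : {lrmorphism H -> H'}).
Variables (tau : {linear tens B H -> tens H B}).
Variables (tau' : {linear tens B H' -> tens H' B}).
Hypothesis etau : forall s, tmap e idfun (tau s) = tau' (tmap idfun e s).

Lemma stepH_nat h' t :
  tmap e idfun (stepH tau h' t) = stepH tau' (e h') (tmap e idfun t).
Proof.
elim/tens_ind: t => [h y|t u tE uE]; last by rewrite !raddfD /= tE uE.
rewrite tmapE !stepHE -(tmapE idfun e) -etau.
elim/tens_ind: (tau _) => [u v|u v uE vE]; last by rewrite !raddfD /= uE vE.
by rewrite !tmapE !lmulE rmorphM.
Qed.

Lemma stepB_nat y t :
  tmap e idfun (stepB tau y t) = stepB tau' y (tmap e idfun t).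
Proof.
elim/tens_ind: t => [h y'|t u tE uE]; last by rewrite !raddfD /= tE uE.
rewrite tmapE !stepBE -(tmapE idfun e) -etau.
elim/tens_ind: (tau _) => [u v|u v uE vE]; last by rewrite !raddfD /= uE vE.
by rewrite !tmapE !rmulE.
Qed.

Lemma twist_mul_nat s t :
  tmap e idfun (twist_mul tau s t) =
  twist_mul tau' (tmap e idfun s) (tmap e idfun t).
Proof.
elim/tens_ind: s => [h y|s u sE uE]; last first.
  by rewrite linearDl !raddfD /= linearDl sE uE.
elim/tens_ind: t => [h' y'|t u tE uE]; last first.
  by rewrite linearDr !raddfD /= linearDr tE uE.
rewrite !tmapE !twist_mul_pureE -(tmapE idfun e) -etau.
elim/tens_ind: (tau _) => [u v|u v uE vE]; last by rewrite !raddfD /= uE vE.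
by rewrite !tmapE !lmulE !rmulE rmorphM.
Qed.
End Naturality.

(** * Homogeneous components *)

Section Grading.
Variable K : fieldType.

Lemma qcomp_lin (A : qspace K) n c (x y : A) :
  qcomp A n x -> qcomp A n y -> qcomp A n (c *: x + y).
Proof.
by move=> [t _ <-] [u _ <-]; exists (c *: t + u) => //; rewrite linearP.
Qed.

Lemma qcomp0 (A : qspace K) n : qcomp A n 0.
Proof. by exists 0 => //; rewrite raddf0. Qed.

Lemma qcomp_deg0 (A : qspace K) (c : K) : qcomp A 0 c%:A.
Proof. by exists (c : K^o). Qed.

Lemma qcomp_deg0P (A : qspace K) (x : A) :
  qcomp A 0 x -> exists c : K, x = c%:A.
Proof. by move=> [c _ <-]; exists c. Qed.

Lemma qcompS (A : qspace K) n (x y : A) :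
  x \in qgen A -> qcomp A n y -> qcomp A n.+1 (x * y).
Proof.
move=> xA [t _ <-]; exists ((Subsp xA : qgenT A) ⊗ t) => //=.
by rewrite tmapE tmulE.
Qed.

Lemma qcompS_ind (A : qspace K) n (S : A -> Prop) :
  (forall x y, x \in qgen A -> qcomp A n y -> S (x * y)) ->
  (forall x y, S x -> S y -> S (x + y)) ->
  forall x, qcomp A n.+1 x -> S x.
Proof.
move=> SM SD x [t _ <-]; elim/tens_ind: t => [v t|t u tE uE].
  by rewrite /= tmapE tmulE; apply: SM; [apply: valP|exists t].
by rewrite raddfD; apply: SD.
Qed.

Lemma qcomp_deg1 (A : qspace K) (x : A) : x \in qgen A -> qcomp A 1 x.
Proof.
by move=> xA; rewrite -[x]mulr1 -[1]scale1r; apply/qcompS/qcomp_deg0.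
Qed.

Lemma qcomp_deg1P (A : qspace K) (x : A) : qcomp A 1 x -> x \in qgen A.
Proof.
apply: (@qcompS_ind A 0 (fun x => x \in qgen A)) => [u v uA|u v].
  move=> /qcomp_deg0P[c ->].
  by rewrite -scalerAr mulr1; apply: rpredZ.
exact: rpredD.
Qed.

Lemma qcomp_morph (A C : qspace K) (f : {lrmorphism A -> C}) :
  (forall x, x \in qgen A -> f x \in qgen C) ->
  forall n x, qcomp A n x -> qcomp C n (f x).
Proof.
move=> fA; elim=> [|n IH] x.
  by move=> /qcomp_deg0P[c ->]; rewrite linearZ /= rmorph1; apply: qcomp_deg0.
apply: (@qcompS_ind A n (fun x => qcomp C n.+1 (f x))) => [u v uA vA|u v uC vC].
  by rewrite rmorphM; apply: qcompS; [apply: fA|apply: IH].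
by rewrite raddfD /= -[f u]scale1r; apply: qcomp_lin.
Qed.

(** A quantum space is spanned by its homogeneous components. *)
Lemma qcomp_ind (A : qspace K) (S : A -> Prop) :
  (forall n x, qcomp A n x -> S x) ->
  (forall c x y, S x -> S y -> S (c *: x + y)) -> forall x, S x.
Proof.
move=> SX Slin.
pose G : set A := [set x | exists n, qcomp A n x].
suff GA x : x \in span G.
  move=> x; elim/span_ind: (GA x) => [u [n]|//|]; first exact: SX.
  - by apply: (SX 0%N); apply: qcomp0.
  - exact: Slin.
(* Left multiplication by A_1 preserves the span of the components, hence so
   does left multiplication by A, and this span contains 1. *)
suff : forall y, y \in span G -> x * y \in span G.
  rewrite -[x in x \in _]mulr1; apply; apply: sub_span; exists 0%N.
  by rewrite -[1]scale1r; apply: qcomp_deg0.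
elim/qspace_ind: x => [x xA|y|c x y xG yG z zG|x y xG yG z zG].
- move=> y yG; elim/span_ind: yG => [u [n un]||c u v uG vG].
  + by apply: sub_span; exists n.+1; apply: qcompS.
  + by rewrite mulr0 rpred0.
  + by rewrite mulrDr -scalerAr; apply: rpredD => //; apply: rpredZ.
- by rewrite mul1r.
- rewrite mulrDl -scalerAl; apply: rpredD; last exact: yG.
  by apply/rpredZ/xG.
- by rewrite -mulrA; apply/xG/yG.
Qed.

Lemma conic_comp (A : cqspace K) N (u : nat -> A) :
  (forall n, qcomp A n (u n)) -> \sum_(n < N) u n = 0 ->
  forall n, (n < N)%N -> u n = 0.
Proof.
move=> uA; have /all_sig[t tE] n : {t | qproj A n t = u n}.
  by apply: cid; have [t _ <-] := uA n; exists t.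
move=> u0 n nN; rewrite -tE; apply: (conic_graded (cqspaceP A) (N := N)) => //.
by rewrite -[RHS]u0; apply: eq_bigr => i _; rewrite tE.
Qed.

Lemma conic_intro (A : qspace K) :
  (forall N (u : nat -> A), (forall n, qcomp A n (u n)) ->
    \sum_(n < N) u n = 0 -> forall n, (n < N)%N -> u n = 0) -> conic A.
Proof.
move=> Agr; split=> [N t t0 n nN|c /eqP|t].
- by apply: (Agr N (fun n => qproj A n (t n))) => // k; exists (t k).
- by rewrite /= /scalar_fun scaler_eq0 oner_eq0 orbF => /eqP.
suff [v ->] : exists v : qgenT A, t = v ⊗ (1 : K^o).
  rewrite /= tmapE tmulE /= /scalar_fun scale1r mulr1 => v0.
  suff -> : v = 0 by rewrite linear0l.
  by apply: val_inj; rewrite /= v0.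
elim/tens_ind: t => [v c|_ _ [v ->] [w ->]]; last first.
  by exists (v + w); rewrite linearDl.
by exists ((c : K) *: v); rewrite linearZl_LR -linearZr_LR /= [_ *: _]mulr1.
Qed.

(** A quantum space that embeds into a product of conic ones is conic. *)
Lemma conic_joint (A : qspace K) (I : Type) (C : I -> cqspace K)
    (f : forall i, {lrmorphism A -> C i}) :
  (forall i x, x \in qgen A -> f i x \in qgen (C i)) ->
  (forall x, (forall i, f i x = 0) -> x = 0) -> conic A.
Proof.
move=> fA finj; apply: conic_intro => N u uA u0 n nN; apply: finj => i.
apply: (@conic_comp _ N (fun n => f i (u n))) => // [k|].
  by apply: qcomp_morph => //; apply: fA.
by rewrite -raddf_sum u0 raddf0.
Qed.

(** The augmentation of a conic quantum space is the projection onto its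
    component of degree 0. *)
Lemma augmentation (A : cqspace K) : exists eps : {linear A -> K^o},
  [/\ eps 1 = 1, forall x y, eps (x * y) = eps x * eps y :> K &
      forall x, x \in qgen A -> eps x = 0].
Proof.
(* R x c says that c is the component of degree 0 in some homogeneous
   decomposition u of x. *)
pose R (x : A) (c : K^o) := exists N (u : nat -> A),
  [/\ forall n, qcomp A n (u n), u 0%N = (c : K)%:A &
      forall M, (N <= M)%N -> x = \sum_(n < M) u n].
have Rlin (c : K) x x' d d' : R x d -> R x' d' -> R (c *: x + x') (c *: d + d').
  move=> [N [u [uA u0 uE]]] [N' [u' [uA' u0' uE']]].
  exists (maxn N N'), (fun n => c *: u n + u' n); split.
  - by move=> n; apply: qcomp_lin.
  - by rewrite u0 u0' scalerA -scalerDl.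
  - move=> M; rewrite geq_max => /andP[NM NM'].
    by rewrite big_split /= -scaler_sumr -uE // -uE'.
have Rhom n x c : qcomp A n x -> (if n is 0 then x = c%:A else c = 0) -> R x c.
  move=> xn xc; exists n.+1, (fun k => if k == n then x else 0); split.
  - by move=> k; case: eqP => [->|_] //; apply: qcomp0.
  - by case: n xn xc => [|n] _ ->; rewrite //= scale0r.
  - move=> M nM; rewrite (bigD1 (Ordinal nM)) //= eqxx big1 ?addr0 // => k.
    by rewrite -val_eqE /= => /negPf ->.
have Rf x c d : R x c -> R x d -> c = d.
  move=> xc xd; have := Rlin (-1) _ _ _ _ xc xd.
  rewrite scaleN1r addNr => -[N [u [uA u0 uE]]].
  have /(_ 0%N isT) := conic_comp uA (esym (uE N.+1 (leqnSn _))).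
  move/eqP; rewrite u0 scaler_eq0 oner_eq0 orbF.
  by rewrite [_ *: _]mulN1r addrC subr_eq0 => /eqP.
have [|x c d||eps epsP] := @linear_of_rel K A K^o R.
- elim/qcomp_ind => [[|n] x xn|c x y [d xd] [d' yd]].
  + by have [c xE] := qcomp_deg0P xn; exists c; apply: Rhom xn _.
  + by exists 0; apply: Rhom xn _.
  + by exists (c *: d + d'); apply: Rlin.
- exact: Rf.
- by move=> c u u' v v'; apply: Rlin.
have epsE x c : R x c -> eps x = c by apply: Rf.
have eps1 : eps 1 = 1.
  apply/epsE/(@Rhom 0%N); rewrite ?scale1r //.
  by have := qcomp_deg0 A 1; rewrite scale1r.
have epsS n x : qcomp A n.+1 x -> eps x = 0.
  by move=> xn; apply/epsE/(Rhom n.+1).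
have epsA x : x \in qgen A -> eps x = 0 by move/qcomp_deg1; apply: epsS.
exists eps; split=> //.
elim/qspace_ind => [x xA|y|c x x' xE xE' y|x x' xE xE' y].
- elim/qcomp_ind => [n y yn|c y z yE zE].
    by rewrite (epsA x) // mul0r; apply: epsS; apply: qcompS yn.
  by rewrite mulrDr -scalerAr !linearP yE zE (epsA x) // !mul0r scaler0 addr0.
- by rewrite eps1 !mul1r.
- by rewrite mulrDl -scalerAl !linearP /= xE xE' mulrDl -mulrA.
- by rewrite -mulrA !xE xE' mulrA.
Qed.
End Grading.

(** * Spanning families and generated quantum spaces *)

Section Spanning.
Variables (K : fieldType) (V W : lmodType K) (n m : nat).
Variables (a : 'I_n -> V) (b : 'I_m -> W) (b' : 'I_m -> dual W).
Hypotheses (ha : basis a) (hb : basis b) (hb' : dual_basis b b').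

Lemma dual_linear (f : dual W) :
  exists f' : {linear W -> K^o}, forall x, subsp_val f x = f' x.
Proof.
have /asboolP fl := valP f.
pose fm := GRing.isLinear.Build K W K^o *:%R (val f) fl.
by pose f' : {linear W -> K^o} := HB.pack (val f) fm; exists f'.
Qed.

Lemma dual_basis_coord (j : 'I_m) (c : 'I_m -> K) :
  subsp_val (b' j) (\sum_k c k *: b k) = c j.
Proof.
have [g gE] := dual_linear (b' j); rewrite gE linear_sum (bigD1 j) //=.
rewrite linearZ /= -gE hb' eqxx [_ *: _]mulr1 big1 ?addr0 // => k kj.
by rewrite linearZ /= -gE hb' eq_sym (negPf kj) scaler0.
Qed.

Lemma dual_decomp (f : dual W) :
  f = \sum_j (subsp_val f (b j) : K) *: b' j.
Proof.
apply: val_inj; rewrite /= raddf_sum; apply/funext => x /=.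
rewrite fct_sumE; have [c [-> _]] := hb x.
have [f' fE] := dual_linear f; rewrite fE linear_sum; apply: eq_bigr => j _.
rewrite linearZ /= -fE -[RHS]/(subsp_val f (b j) * subsp_val (b' j) _).
by rewrite dual_basis_coord [LHS]mulrC.
Qed.

(** The vectors b' j (x) a i span W^* (x) V. *)
Lemma dual_tens_span (w : tens (dual W) V) :
  w \in span [set` allpairs (fun i j => b' j ⊗ a i) (enum 'I_n) (enum 'I_m)].
Proof.
elim/tens_ind: w => [f v|x y]; last exact: rpredD.
rewrite (dual_decomp f); have [c [-> _]] := ha v.
rewrite linear_sumlz; apply: rpred_sum => j _.
rewrite linear_sumr; apply: rpred_sum => i _.
rewrite linearZl_LR linearZr_LR; do 2!apply: rpredZ.
by apply/sub_span/allpairsP; exists (i, j); rewrite !mem_enum.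
Qed.

Lemma dual_tens_ext (U : lmodType K) (f g : {linear tens (dual W) V -> U}) :
  (forall i j, f (b' j ⊗ a i) = g (b' j ⊗ a i)) -> f =1 g.
Proof.
move=> fg w; elim/span_ind: (dual_tens_span w) => [_ /allpairsP[p [_ _ ->]]||].
- exact: fg.
- by rewrite !raddf0.
- by move=> c x y xE yE; rewrite !linearP xE yE.
Qed.

Lemma dual_tens_img (U : lmodType K) (f : {linear tens (dual W) V -> U}) w :
  f w \in span [set` allpairs (fun i j => f (b' j ⊗ a i))
    (enum 'I_n) (enum 'I_m)].
Proof.
elim/span_ind: (dual_tens_span w) => [_ /allpairsP[p [_ _ ->]]||c x y xE yE].
- by apply/sub_span/allpairsP; exists p; rewrite !mem_enum.
- by rewrite raddf0 rpred0.
- by rewrite linearP rpredD // rpredZ.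
Qed.
End Spanning.

Section GeneratedMaps.
Variables (K : fieldType) (A : algType K) (s : seq A) (W : lmodType K).
Variable f : {linear W -> A}.
Local Notation G := (gen_qspace s).

Lemma gen_val_inj (v : qgenT G) : subal_val (subsp_val v) = 0 :> A -> v = 0.
Proof. by move=> v0; apply/val_inj/val_inj. Qed.

(** A linear map into the span of s corestricts to the generators of the
    quantum space generated by s. *)
Lemma gen_corestrict : (forall w, f w \in span [set` s]) ->
  exists g : {linear W -> qgenT G}, forall w, subal_val (subsp_val (g w)) = f w.
Proof.
move=> fs.
have vlin : linear (fun v : qgenT G => subal_val (subsp_val v) : A).
  by move=> c x y; rewrite !linearP.
pose vm := GRing.isLinear.Build K (qgenT G) A *:%R _ vlin.
pose v : {linear qgenT G -> A} :=
  HB.pack (fun v : qgenT G => subal_val (subsp_val v) : A) vm.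
have [||g gE] := @joint_lift K W (qgenT G) unit (fun=> A) (fun=> v) (fun=> f).
- by move=> x /(_ tt) /gen_val_inj.
- move=> w; have ws : f w \in subalg_gen [set` s].
    apply: (@span_min K A [set` s] (subalg_gen [set` s])) (fs w).
    by move=> x xs; apply: sub_subalg_gen.
  have gw : (Subal ws : G) \in qgen G by exact: (fs w).
  by exists (Subsp gw).
- by exists g => w; apply: (gE tt).
Qed.

Lemma gen_qgen_img (x : G) : (forall y, y \in s -> exists w, f w = y) ->
  x \in qgen G -> exists w, f w = subal_val x.
Proof.
move=> sf; rewrite -[x \in qgen G]/(subal_val x \in span [set` s]).
elim/span_ind => [y /sf //||c y z [w <-] [w' <-]].
- by exists 0; rewrite raddf0.
- by exists (c *: w + w'); rewrite linearP.
Qed.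
End GeneratedMaps.

(** * Tensor products of subspaces *)

Section Tsub.
Variable K : fieldType.

Lemma tsub_in (V W : lmodType K) (X : set V) (Y : set W) v w :
  X v -> Y w -> v ⊗ w \in tsub X Y.
Proof. by move=> Xv Yw; apply: sub_span; exists v, w. Qed.

Lemma tsub_ind (V W : lmodType K) (X : set V) (Y : set W)
    (S : tens V W -> Prop) :
  (forall v w, X v -> Y w -> S (v ⊗ w)) -> S 0 ->
  (forall c x y, S x -> S y -> S (c *: x + y)) ->
  forall t, t \in tsub X Y -> S t.
Proof.
move=> SXY S0 Slin; apply: span_ind => // _ [v [w [Xv Yw ->]]]; exact: SXY.
Qed.

Lemma tsub_tmap (V V' W W' : lmodType K) (X : set V) (Y : set W) (X' : set V')
    (Y' : set W') (f : {linear V -> V'}) (g : {linear W -> W'}) t :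
  (forall v, X v -> X' (f v)) -> (forall w, Y w -> Y' (g w)) ->
  t \in tsub X Y -> tmap f g t \in tsub X' Y'.
Proof.
move=> fX gY; elim/tsub_ind => [v w Xv Yw||c x y xS yS].
- by rewrite tmapE tsub_in //; [apply: fX|apply: gY].
- by rewrite raddf0 rpred0.
- by rewrite linearP rpredD // rpredZ.
Qed.

Lemma sub_tsub (V W : lmodType K) (X X' : set V) (Y Y' : set W) t :
  X `<=` X' -> Y `<=` Y' -> t \in tsub X Y -> t \in tsub X' Y'.
Proof.
move=> XX YY; elim/tsub_ind => [v w Xv Yw||c x y xS yS].
- by rewrite tsub_in //; [apply: XX|apply: YY].
- exact: rpred0.
- by rewrite rpredD // rpredZ.
Qed.
End Tsub.

(** * Models of the defining relations and the algebra they generate *)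

Section Models.
Variables (K : fieldType) (A B : cqspace K) (n m : nat).
Variables (a : 'I_n -> qgenT A) (b : 'I_m -> qgenT B).
Variable b' : 'I_m -> dual (qgenT B).

Local Notation A1 := (qgenT A).
Local Notation B1 := (qgenT B).
Local Notation BA := (tens (dual B1) A1).

Variable tauhat : {linear tens B1 BA -> tens B1 BA}.

(** A model is an algebra with a linear map from the dual of B_1 tensored with
    A_1, an injective twisting map that restricts to the flip of tauhat, and an
    algebra map psi from A to the twisted tensor product that is the canonical
    coaction on A_1. It is moreover a subalgebra of a conic quantum space with
    the given map valued in degree 1. Each object of the category yields a
    model carried by its algebra H^phi. *)
Record model := Model {
  mod_alg : algType K;
  mod_pi : {linear BA -> mod_alg};
  mod_tau : {linear tens B mod_alg -> tens mod_alg B};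
  mod_psi : {linear A -> tens mod_alg B};
  mod_conic : cqspace K;
  mod_in : {lrmorphism mod_alg -> mod_conic};
  mod_twist : twisting mod_tau;
  mod_tau_inj : injective mod_tau;
  mod_tauE : forall x, mod_tau (tmap subsp_val mod_pi x) =
    tflip (tmap subsp_val mod_pi (tauhat x));
  mod_psi1 : mod_psi 1 = 1 ⊗ 1;
  mod_psiM : forall x y,
    mod_psi (x * y) = twist_mul mod_tau (mod_psi x) (mod_psi y);
  mod_psiE : forall x : A1, mod_psi (subsp_val x) =
    \sum_j mod_pi (b' j ⊗ x) ⊗ subsp_val (b j);
  mod_in_inj : injective mod_in;
  mod_in_gen : forall w, mod_in (mod_pi w) \in qgen mod_conic
}.

Section Lift.
Variables (P : qspace K) (pi : {linear BA -> P}).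
Variable e : forall M : model, {lrmorphism P -> mod_alg M}.
Hypothesis pi_gen : forall w, pi w \in qgen P.
Hypothesis pi_onto : forall x, x \in qgen P -> exists w, pi w = x.
Hypothesis e_pi : forall M w, e M (pi w) = mod_pi M w.
Hypothesis e_inj : forall x, (forall M, e M x = 0) -> x = 0.

Lemma eB_inj (W : lmodType K) (t u : tens P W) :
  (forall M, tmap (e M) idfun t = tmap (e M) idfun u) -> t = u.
Proof.
move=> tu; apply/subr0_eq/(tmap_joint_inj e_inj) => M.
by rewrite raddfB /= tu subrr.
Qed.

Lemma Be_inj (W : lmodType K) (t u : tens W P) :
  (forall M, tmap idfun (e M) t = tmap idfun (e M) u) -> t = u.
Proof.
move=> tu; apply/subr0_eq/(tmap_joint_injr e_inj) => M.
by rewrite raddfB /= tu subrr.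
Qed.

(** The twisting maps of all models lift simultaneously, and with values in
    P (x) B_1 when the factor in B has degree 1; the latter is what allows an
    induction over products in P before one over products in B. *)
Lemma tau_lift_gen (x : P) (y : B1) : exists t : tens P B1, forall M,
  tmap (e M) subsp_val t = mod_tau M (subsp_val y ⊗ e M x).
Proof.
elim/qspace_ind: x y => [x /pi_onto[w <-] y|y|c x x' xS xS' y|x x' xS xS' y].
- exists (tmap pi idfun (tflip (tauhat (y ⊗ w)))) => M.
  rewrite e_pi -(tmapE subsp_val (mod_pi M)) mod_tauE tflip_tmap.
  by apply: tmap_comp => // v; rewrite /= e_pi.
- by exists (1 ⊗ y) => M; rewrite tmapE !rmorph1 (twisting_1H (mod_twist M)).
- have [[t tE] [t' tE']] := (xS y, xS' y).
  by exists (c *: t + t') => M; rewrite !linearP tE tE' /= linearPr linearP.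
have [t tE] := xS y.
suff [u uE] : exists u : tens P B1, forall M, tmap (e M) subsp_val u =
    stepH (mod_tau M) (e M x') (tmap (e M) subsp_val t).
  by exists u => M; rewrite uE tE rmorphM -twisting_mulHE //; apply: mod_twist.
elim/tens_ind: {x xS y tE} t => [p q|t t' [u uE] [u' uE']].
  have [u uE] := xS' q; exists (tmap (lmul p) idfun u) => M.
  rewrite tmapE stepHE -uE.
  by apply: tmap_square => // v; rewrite !lmulE rmorphM.
by exists (u + u') => M; rewrite !raddfD /= uE uE'.
Qed.

Lemma tau_lift (y : B) (x : P) : exists t : tens P B, forall M,
  tmap (e M) idfun t = mod_tau M (y ⊗ e M x).
Proof.
elim/qspace_ind: y x => [y yB x|x|c y y' yS yS' x|y y' yS yS' x].
- have [t tE] := tau_lift_gen x (Subsp yB).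
  by exists (tmap idfun subsp_val t) => M; rewrite -tE; apply: tmap_comp.
- by exists (x ⊗ 1) => M; rewrite tmapE (twisting_1B (mod_twist M)).
- have [[t tE] [t' tE']] := (yS x, yS' x).
  by exists (c *: t + t') => M; rewrite !linearP tE tE' /= linearPl linearP.
have [t tE] := yS' x.
suff [u uE] : exists u : tens P B, forall M, tmap (e M) idfun u =
    stepB (mod_tau M) y (tmap (e M) idfun t).
  by exists u => M; rewrite uE tE -twisting_mulBE //; apply: mod_twist.
elim/tens_ind: {x yS' tE} t => [p q|t t' [u uE] [u' uE']].
  have [u uE] := yS p; exists (tmap idfun (rmul q) u) => M.
  rewrite tmapE stepBE -uE.
  exact: tmap_square.
by exists (u + u') => M; rewrite !raddfD /= uE uE'.
Qed.

Lemma exists_tau : exists tau : {linear tens B P -> tens P B}, forall M s,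
  tmap (e M) idfun (tau s) = mod_tau M (tmap idfun (e M) s).
Proof.
have [|u|tau tauE] := @joint_lift K (tens B P) (tens P B) model
    (fun M => tens (mod_alg M) B) (fun M => tmap (e M) idfun)
    (fun M => mod_tau M \o tmap idfun (e M)).
- exact: tmap_joint_inj.
- elim/tens_ind: u => [y x|t t' [u uE] [u' uE']].
    by have [t tE] := tau_lift y x; exists t => M; rewrite /= tmapE tE.
  exists (u + u') => M; rewrite [LHS]raddfD [RHS]raddfD.
  by congr (_ + _); [apply: uE|apply: uE'].
- by exists tau => M s; rewrite tauE.
Qed.

Variable tau : {linear tens B P -> tens P B}.
Hypothesis tauE : forall M s,
  tmap (e M) idfun (tau s) = mod_tau M (tmap idfun (e M) s).

Lemma lift_twisting : twisting tau.
Proof.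
apply: twisting_pure => [y h h'|y y' h|y|h]; apply: eB_inj => M.
- rewrite (stepH_nat (tauE M)) !tauE !tmapE rmorphM.
  by rewrite -twisting_mulHE //; apply: mod_twist.
- rewrite (stepB_nat (tauE M)) !tauE !tmapE.
  by rewrite -twisting_mulBE //; apply: mod_twist.
- by rewrite tauE !tmapE !rmorph1 (twisting_1H (mod_twist M)).
- by rewrite tauE !tmapE (twisting_1B (mod_twist M)).
Qed.

Lemma lift_tauE x :
  tau (tmap subsp_val pi x) = tflip (tmap subsp_val pi (tauhat x)).
Proof.
have ePi M u : tmap (idfun : {linear B -> B}) (e M) (tmap subsp_val pi u) =
    tmap subsp_val (mod_pi M) u.
  by apply: tmap_comp => // w; apply: e_pi.
by apply: eB_inj => M; rewrite tauE ePi mod_tauE -ePi tflip_tmap.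
Qed.

Lemma lift_tau_inj : injective tau.
Proof.
move=> s s' ss; apply: Be_inj => M; apply: (@mod_tau_inj M).
by rewrite -!tauE ss.
Qed.

(** On generators of P this is the surjectivity of tauhat; the hexagon identity
    propagates it to products. *)
Lemma lift_tau_surj_gen (tauhat_surj : forall x, exists y, tauhat y = x)
    (x : P) (y : B1) : exists s : tens B1 P,
  tau (tmap subsp_val idfun s) = x ⊗ subsp_val y.
Proof.
elim/qspace_ind: x y => [x /pi_onto[w <-] y|y|c x x' xS xS' y|x x' xS xS' y].
- have [u uE] := tauhat_surj (y ⊗ w); exists (tmap idfun pi u).
  rewrite (@tmap_comp _ _ _ _ _ _ _ _ _ subsp_val _ _ pi) //.
  by rewrite lift_tauE uE tmapE tflipE.
- by exists (y ⊗ 1); rewrite tmapE (twisting_1H lift_twisting).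
- have [[t tE] [t' tE']] := (xS y, xS' y).
  by exists (c *: t + t'); rewrite !linearP tE tE' linearPl.
have [t tE] := xS' y.
suff [u uE] : exists u : tens B1 P, tau (tmap subsp_val idfun u) =
    tmap (lmul x) idfun (tau (tmap subsp_val idfun t)).
  by exists u; rewrite uE tE tmapE lmulE.
elim/tens_ind: {tE} t => [q p|t t' [u uE] [u' uE']]; last first.
  by exists (u + u'); rewrite !raddfD /= uE uE'.
have [u uE] := xS q; exists (tmap idfun (rmul p) u).
rewrite tmapE -stepHE -uE.
elim/tens_ind: {uE} u => [v w|u v uE vE]; last by rewrite !raddfD /= uE vE.
by rewrite !tmapE rmulE (twisting_mulHE lift_twisting).
Qed.

Lemma lift_tau_surj (tauhat_surj : forall x, exists y, tauhat y = x) :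
  forall t, exists s, tau s = t.
Proof.
suff surj y x : exists s, tau s = x ⊗ y.
  elim/tens_ind => [x y|t t' [s <-] [s' <-]]; first exact: surj.
  by exists (s + s'); rewrite raddfD.
elim/qspace_ind: y x => [y yB x|x|c y y' yS yS' x|y y' yS yS' x].
- have [s sE] := lift_tau_surj_gen tauhat_surj x (Subsp yB).
  by exists (tmap subsp_val idfun s).
- by exists (1 ⊗ x); rewrite (twisting_1B lift_twisting).
- have [[t tE] [t' tE']] := (yS x, yS' x).
  by exists (c *: t + t'); rewrite linearP tE tE' linearPr.
have [t tE] := yS x.
suff [u uE] : exists u, tau u = tmap idfun (rmul y') (tau t).
  by exists u; rewrite uE tE tmapE rmulE.
elim/tens_ind: {tE} t => [q p|t t' [u uE] [u' uE']]; last first.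
  by exists (u + u'); rewrite !raddfD /= uE uE'.
have [u uE] := yS' p; exists (tmap (lmul q) idfun u).
rewrite -stepBE -uE.
elim/tens_ind: {uE} u => [v w|u v uE vE]; last by rewrite !raddfD /= uE vE.
by rewrite !tmapE lmulE (twisting_mulBE lift_twisting).
Qed.

Lemma lift_tau_bij : bijective tauhat -> bijective tau.
Proof.
move=> [g _ gK]; have surj : forall t, exists s, tau s = t.
  by apply: lift_tau_surj => x; exists (g x).
have [f fP] := choice surj; exists f => // s.
by apply: lift_tau_inj; rewrite fP.
Qed.

Lemma lift_tau_deg k x y : qcomp P k x -> y \in qgen B ->
  tau (y ⊗ x) \in tsub (qcomp P k) [set` qgen B].
Proof.
elim: k x y => [|k IH] x y xk yB.
  have [c ->] := qcomp_deg0P xk; rewrite linearZr_LR linearZ /=.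
  rewrite (twisting_1H lift_twisting) rpredZ // tsub_in //.
  by rewrite -[1]scale1r; apply: qcomp_deg0.
move: x xk; apply: qcompS_ind => [u v uP vk|u v uS vS]; last first.
  by rewrite linearDr raddfD rpredD.
have [w uE] := pi_onto uP.
rewrite (twisting_mulHE lift_twisting) -{u uP}uE.
have -> : tau (y ⊗ pi w) = tmap pi subsp_val (tflip (tauhat (Subsp yB ⊗ w))).
  by rewrite -tflip_tmap -lift_tauE tmapE.
elim/tens_ind: (tflip _) => [p q|t t' tS tS']; last first.
  by rewrite !raddfD /= rpredD.
rewrite tmapE stepHE.
have /IH : qcomp P k v by [].
move=> /(_ _ (valP q)); apply: tsub_tmap => // x xk.
exact: qcompS.
Qed.

Lemma lift_symmetric : bijective tauhat -> symmetric_twist (H := P) tau.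
Proof.
move=> hbij; split; first exact: lift_tau_bij.
move=> x; elim/tsub_ind => [y p yB pP||c u v uS vS].
- apply: (@sub_tsub _ _ _ (qcomp P 1) _ [set` qgen B]) => // [z|].
    exact: qcomp_deg1P.
  by apply: lift_tau_deg => //; apply: qcomp_deg1.
- by rewrite raddf0 rpred0.
- by rewrite linearP rpredD // rpredZ.
Qed.

Lemma exists_psi : exists psi : {linear A -> tens P B}, forall M x,
  tmap (e M) idfun (psi x) = mod_psi M x.
Proof.
have [|x|psi psiE] := @joint_lift K A (tens P B) model
    (fun M => tens (mod_alg M) B) (fun M => tmap (e M) idfun)
    (fun M => mod_psi M).
- exact: tmap_joint_inj.
- elim/qspace_ind: x => [x xA||c x y [t tE] [u uE]|x y [t tE] [u uE]].
  + exists (\sum_j pi (b' j ⊗ (Subsp xA : A1)) ⊗ subsp_val (b j)) => M.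
    have := mod_psiE M (Subsp xA); rewrite /= => ->.
    rewrite raddf_sum; apply: eq_bigr => j _ /=.
    by rewrite tmapE /= e_pi.
  + by exists (1 ⊗ 1) => M; rewrite tmapE !rmorph1 mod_psi1.
  + by exists (c *: t + u) => M; rewrite !linearP tE uE.
  + exists (twist_mul tau t u) => M.
    by rewrite (twist_mul_nat (tauE M)) tE uE mod_psiM.
- by exists psi => M s; rewrite psiE.
Qed.

Variable psi : {linear A -> tens P B}.
Hypothesis psiE : forall M x, tmap (e M) idfun (psi x) = mod_psi M x.

Lemma lift_psi_gen (x : A1) :
  psi (subsp_val x) = \sum_j pi (b' j ⊗ x) ⊗ subsp_val (b j).
Proof.
apply: eB_inj => M; rewrite psiE mod_psiE raddf_sum; apply: eq_bigr => j _ /=.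
by rewrite tmapE /= e_pi.
Qed.

Lemma lift_psi1 : psi 1 = 1 ⊗ 1.
Proof. by apply: eB_inj => M; rewrite psiE tmapE !rmorph1 mod_psi1. Qed.

Lemma lift_psiM x y : psi (x * y) = twist_mul tau (psi x) (psi y).
Proof.
by apply: eB_inj => M; rewrite (twist_mul_nat (tauE M)) !psiE mod_psiM.
Qed.

Lemma lift_psi_in1 x : x \in qgen A ->
  psi x \in tsub [set` qgen P] [set` qgen B].
Proof.
move=> xA; rewrite -[x]/(subsp_val (Subsp xA : A1)) lift_psi_gen.
by apply: rpred_sum => j _; apply: tsub_in; [apply: pi_gen|apply: valP].
Qed.

Lemma lift_circ_morph : circ_morph (H := P) tau psi.
Proof.
split; [|exact: lift_psi1|exact: lift_psiM|exact: lift_psi_in1].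
move=> x; apply/asboolP => S S1 SM SX.
elim/qspace_ind: x => [x /lift_psi_in1/SX||c x y xS yS|x y xS yS] //.
- by rewrite lift_psi1.
- by rewrite linearP rpredD // rpredZ.
- by rewrite lift_psiM SM.
Qed.

Lemma lift_psi_homog k x :
  qcomp A k x -> psi x \in tsub (qcomp P k) (qcomp B k).
Proof.
elim: k x => [|k IH] x.
  move=> /qcomp_deg0P[c ->]; rewrite linearZ /= lift_psi1 rpredZ // tsub_in //.
    by rewrite -[1]scale1r; apply: qcomp_deg0.
  by rewrite -[1]scale1r; apply: qcomp_deg0.
move: x; apply: qcompS_ind => [u v uA vk|u v uS vS]; last first.
  by rewrite raddfD rpredD.
rewrite lift_psiM; have := IH _ vk; move: (psi v) => t.
elim/tsub_ind => [p q pP qB||c t' u' tS uS].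
- have := lift_psi_in1 uA; move: (psi u) => t'.
  elim/tsub_ind => [h y hP yB||c s s' sS sS'].
  + rewrite twist_mul_pureE.
    apply: tsub_tmap (lift_tau_deg pP yB) => [z zk|z zB].
      exact: qcompS.
    exact: qcompS.
  + by rewrite linear0l rpred0.
  + by rewrite linearPl rpredD // rpredZ.
- by rewrite linear0r rpred0.
- by rewrite linearPr rpredD // rpredZ.
Qed.

(** The map tauhat descends to the generators of P, and the twisting map
    restricts to the flip of the descended map. *)
Lemma exists_tauhat_phi (pi1 : {linear BA -> qgenT P}) :
  (forall w, subsp_val (pi1 w) = pi w) ->
  exists th : {linear tens B1 (qgenT P) -> tens B1 (qgenT P)},
  (forall x, th (tmap idfun pi1 x) = tmap idfun pi1 (tauhat x)) /\
  (forall x, tau (tmap subsp_val subsp_val x) =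
     tmap subsp_val subsp_val (tflip (th x))).
Proof.
move=> pi1E.
pose v : {linear tens B1 (qgenT P) -> tens B P} := tmap subsp_val subsp_val.
have vinj : injective v by apply: tmap_inj; apply: val_inj.
have vpi x : v (tmap idfun pi1 x) = tmap subsp_val pi x.
  by apply: tmap_comp => // w; rewrite pi1E.
have onto (u : tens B1 (qgenT P)) : exists x, tmap idfun pi1 x = u.
  elim/tens_ind: u => [y p|_ _ [x <-] [x' <-]]; last first.
    by exists (x + x'); rewrite raddfD.
  have [w wE] := pi_onto (valP p); exists (y ⊗ w); rewrite tmapE /=.
  by congr (_ ⊗ _); apply: val_inj; rewrite /= pi1E wE.
have [|u|th thE] := @joint_lift K _ (tens B1 (qgenT P)) unit
    (fun=> tens B P) (fun=> v) (fun=> tflip \o (tau \o v)).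
- by move=> t /(_ tt) tE; apply: vinj; rewrite tE raddf0.
- have [x <-] := onto u; exists (tmap idfun pi1 (tauhat x)) => _ /=.
  by rewrite !vpi lift_tauE tflipK.
exists th; split=> x.
  by apply: vinj; rewrite (thE tt) /= !vpi lift_tauE tflipK.
by rewrite -tflip_tmap -[tmap _ _ (th x)]/(v (th x)) (thE tt) /= tflipK.
Qed.
End Lift.

End Models.

(** * Objects of the category as models *)

Section Coordinates.
Variables (K : fieldType) (B : qspace K) (m : nat).
Variables (b : 'I_m -> qgenT B) (b' : 'I_m -> dual (qgenT B)).
Hypothesis hb' : dual_basis b b'.

(** The element b' j extends to a functional on all of B, which reads off the
    coefficients of the b k in a tensor product with B. *)
Lemma coord_functional j : exists F : {linear B -> K^o},
  forall (V : lmodType K) (x : 'I_m -> V),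
  contr F (\sum_k x k ⊗ subsp_val (b k)) = x j.
Proof.
have [g gE] := dual_linear (b' j).
have [F FE] := extend_functional g (@val_inj _ _ (qgenT B)).
exists F => V x; rewrite linear_sum (bigD1 j) //= contrE FE -gE hb' eqxx.
rewrite scale1r big1 ?addr0 // => k kj.
by rewrite contrE FE -gE hb' eq_sym (negPf kj) scale0r.
Qed.

Lemma coord_uniq (V : lmodType K) (x y : 'I_m -> V) :
  \sum_k x k ⊗ subsp_val (b k) = \sum_k y k ⊗ subsp_val (b k) -> x =1 y.
Proof.
by move=> xy j; have [F FE] := coord_functional j; rewrite -FE xy FE.
Qed.

Lemma coord_in (V : lmodType K) (S : submodClosed V) (Y : set B)
    (x : 'I_m -> V) :
  \sum_k x k ⊗ subsp_val (b k) \in tsub [set` S] Y -> forall j, x j \in S.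
Proof.
move=> xS j; have [F <-] := coord_functional j; move: xS.
elim/tsub_ind => [v w vS _||c u v uS vS].
- by rewrite contrE rpredZ.
- by rewrite raddf0 rpred0.
- by rewrite linearP rpredD // rpredZ.
Qed.
End Coordinates.

Section Construction.
Variables (K : fieldType) (A B : cqspace K) (n m : nat).
Variables (a : 'I_n -> qgenT A) (b : 'I_m -> qgenT B).
Variable b' : 'I_m -> dual (qgenT B).
Hypotheses (ha : basis a) (hb : basis b) (hb' : dual_basis b b').

Local Notation A1 := (qgenT A).
Local Notation B1 := (qgenT B).
Local Notation BA := (tens (dual B1) A1).

Variable tauhat : {linear tens B1 BA -> tens B1 BA}.
Local Notation model := (model b b' tauhat).

(** Each object of the category yields a model, together with the inclusion
    of H^phi in H. *)
Lemma model_of_Upsilon (Y : comma A B) : Upsilon a b b' tauhat Y ->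
  exists (M : model) (v : {lrmorphism mod_alg M -> comma_H Y}),
    (forall x, comma_phi Y x = tmap v idfun (mod_psi M x)) /\
    (forall w, v (mod_pi M w) \in qgen (comma_H Y)).
Proof.
move=> [h [hcoef [pi [piE [th [thE [tau [tw [/bij_inj tinj _] tauE
  [psi [psiP phiE]]]]]]]]]].
pose w : {lrmorphism Hphi h -> comma_H Y} := subal_val.
pose pi' : {linear BA -> Hphi h} := subsp_val \o pi.
have winj : injective w by apply: val_inj.
have tau' x : tau (tmap subsp_val pi' x) =
    tflip (tmap subsp_val pi' (tauhat x)).
  have tpi u : tmap subsp_val pi' u =
      tmap subsp_val subsp_val (tmap idfun pi u) :> tens B (Hphi h).
    by apply/esym/tmap_comp.
  by rewrite !tpi tauE thE -tflip_tmap.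
have vinj : injective (tmap w (idfun : {linear B -> B})).
  by apply: tmap_inj.
have psiE (x : A1) : psi (subsp_val x) =
    \sum_j pi' (b' j ⊗ x) ⊗ subsp_val (b j).
  have psiZ (d : K) (z : A1) :
      psi (subsp_val (d *: z)) = d *: psi (subsp_val z) by rewrite !linearZ.
  have [c [-> _]] := ha x.
  under [in RHS]eq_bigr => j _ do rewrite linear_sumr raddf_sum linear_sumlz.
  rewrite exchange_big raddf_sum /= [LHS]raddf_sum.
  apply: eq_bigr => i _.
  under [in RHS]eq_bigr => j _ do rewrite linearZr_LR linearZ linearZl_LR.
  rewrite -scaler_sumr [LHS]psiZ; congr (_ *: _).
  apply: vinj; rewrite -phiE hcoef raddf_sum.
  by apply: eq_bigr => j _; rewrite -(piE i j); apply/esym/tmapE.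
have wpi x : w (pi' x) \in qgen (comma_H Y).
  have h_gen i j : h i j \in qgen (comma_H Y).
    apply: (coord_in hb' (S := qgen (comma_H Y)) (Y := qcomp B 1)).
    rewrite -hcoef.
    apply: (@sub_tsub _ _ _ (qcomp (comma_H Y) 1) _ (qcomp B 1)).
    - by move=> z /qcomp_deg1P.
    - by [].
    - by apply: comma_homog; apply/qcomp_deg1/valP.
  elim/span_ind: (dual_tens_span ha hb hb' x) => [_ /allpairsP[p [_ _ ->]]||].
  - by rewrite [w _]piE h_gen.
  - by rewrite !raddf0 rpred0.
  - by move=> c y z yS zS; rewrite !linearP rpredD // rpredZ.
exists (Model tw tinj tau' (circ_morph1 psiP) (circ_morphM psiP) psiE winj wpi).
by exists w; split.
Qed.
End Construction.

(** * The initial object *)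

Section Initial.
Variables (K : fieldType) (A B : cqspace K) (n m : nat).
Variables (a : 'I_n -> qgenT A) (b : 'I_m -> qgenT B).
Variable b' : 'I_m -> dual (qgenT B).
Hypotheses (ha : basis a) (hb : basis b) (hb' : dual_basis b b').

Local Notation A1 := (qgenT A).
Local Notation B1 := (qgenT B).
Local Notation BA := (tens (dual B1) A1).

Variable tauhat : {linear tens B1 BA -> tens B1 BA}.
Local Notation model := (model b b' tauhat).

Local Notation G0 := (gen_qspace ([::] : seq K^o)).

Lemma gen_nil_qgen0 (x : G0) : x \in qgen G0 -> x = 0.
Proof.
move=> xG.
have [w /esym] : exists w, (\0 : {linear K^o -> K^o}) w = subal_val x.
  by apply: gen_qgen_img xG.
by move=> x0; apply: val_inj.
Qed.

Lemma gen_nil_conic : conic G0.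
Proof.
apply: conic_intro => N u uG u0 k kN.
(* There are no generators, so the components of positive degree vanish. *)
have uS j : u j.+1 = 0.
  apply: (@qcompS_ind _ G0 j (fun x => x = 0)) (uG j.+1) => [x y|x y -> ->].
    move=> /gen_nil_qgen0 ->.
    by rewrite mul0r.
  by rewrite addr0.
case: k kN => // N0; case: N N0 u0 => // N _.
by rewrite big_ord_recl big1 ?addr0 // => i _; rewrite uS.
Qed.

(** The model with zero generators, carried by the ground field; it is what
    makes the universal algebra nonzero. *)
Lemma trivial_model : inhabited model.
Proof.
have [eps [eps1 epsM epsA]] := augmentation A.
pose psi0 (x : A) : tens G0 B := (eps x : K) *: (1 ⊗ 1).
have psi_lin : linear psi0.
  by move=> c x y; rewrite /psi0 linearP scalerDl scalerA.
pose psim := GRing.isLinear.Build K A (tens G0 B) *:%R psi0 psi_lin.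
pose psi : {linear A -> tens G0 B} := HB.pack psi0 psim.
pose z : {linear BA -> G0} := \0.
have z0 (V : lmodType K) (f : {linear B1 -> V}) t : tmap f z t = 0.
  elim/tens_ind: t => [v w|t u tE uE]; last by rewrite raddfD /= tE uE addr0.
  by rewrite tmapE /= linear0r.
constructor; refine (@Model _ _ _ _ b b' tauhat G0 z tflip psi
  (CQSpace gen_nil_conic) (idfun : {lrmorphism G0 -> G0})
  _ _ _ _ _ _ _ _) => //.
- exact: flip_twisting.
- exact: (can_inj (@tflipK _ _ _)).
- by move=> x; rewrite !z0 !raddf0.
- by rewrite /psi /= /psi0 eps1 scale1r.
- move=> x y; rewrite -[LHS]/(psi0 (x * y)).
  rewrite -[RHS]/(twist_mul tflip (psi0 x) (psi0 y)).
  rewrite /psi0 linearZl_LR linearZr_LR epsM -scalerA.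
  by do 2!congr (_ *: _); rewrite -[RHS]/(twist_mul tflip _ _) flip_mulE !mulr1.
- move=> x; rewrite /psi /= /psi0 epsA ?scale0r; last exact: valP.
  by rewrite big1 // => j _; rewrite linear0l.
- by move=> w; apply: rpred0.
Qed.

(** The component of degree k of H (x) B lies in the subalgebra generated by
    H_1 (x) B_1. *)
Lemma circ_homog (H : qspace K) k t : t \in tsub (qcomp H k) (qcomp B k) ->
  t \in circ H B.
Proof.
move=> tk; apply/asboolP => S S1 SM SX.
move: t tk; elim: k => [|k IH] t.
  elim/tsub_ind => [x y /qcomp_deg0P[c ->] /qcomp_deg0P[d ->]||c x y xS yS].
  - by rewrite linearZl_LR linearZr_LR; do 2!apply: rpredZ.
  - exact: rpred0.
  - by rewrite rpredD // rpredZ.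
elim/tsub_ind => [x y xk yk||c x y xS yS].
- move: x xk; apply: qcompS_ind => [u v uH vk|u v uS vS]; last first.
    by rewrite linearDl rpredD.
  move: y yk; apply: qcompS_ind => [u' v' uB vk'|u' v' uS vS]; last first.
    by rewrite linearDr rpredD.
  rewrite -flip_mulE; apply: SM; first exact/SX/tsub_in.
  exact/IH/tsub_in.
- exact: rpred0.
- by rewrite rpredD // rpredZ.
Qed.

(** The quantum space generated by the images of BA in the algebra of
    expressions modulo all models: it maps to every model, and these maps
    separate its points. *)
Lemma universal_qspace (M0 : model) : exists (H : cqspace K)
    (pH : {linear BA -> H})
    (eH : forall M : model, {lrmorphism H -> mod_alg M}),
  [/\ forall w, pH w \in qgen H,
      forall x, x \in qgen H -> exists w, pH w = x,
      forall M w, eH M (pH w) = mod_pi M w &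
      forall x, (forall M, eH M x = 0) -> x = 0].
Proof.
pose Q := jalg (fun M : model => mod_pi M) M0.
pose qv : {linear BA -> Q} := jvar M0 (fun M => mod_pi M).
pose sQ := allpairs (fun i j => qv (b' j ⊗ a i)) (enum 'I_n) (enum 'I_m).
pose H : qspace K := gen_qspace sQ.
have [piH piHE] := @gen_corestrict K Q sQ BA qv (dual_tens_img ha hb hb' qv).
pose pH : {linear BA -> H} := subsp_val \o piH.
pose eH M : {lrmorphism H -> mod_alg M} :=
  jeval M0 (fun M => mod_pi M) M \o (subal_val : {lrmorphism H -> Q}).
have eHp M w : eH M (pH w) = mod_pi M w.
  by rewrite -(jeval_var M0 (fun M => mod_pi M) M w) -[jvar_fun _ _ _]piHE.
have eH_inj x : (forall M, eH M x = 0) -> x = 0.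
  move=> x0; apply: val_inj; apply: jeval_inj => M.
  by rewrite [LHS]x0 [RHS]jeval0.
have pH_gen w : pH w \in qgen H by exact: (valP (piH w)).
have H_onto x : x \in qgen H -> exists w, pH w = x.
  move=> xH; have [|w wE] := gen_qgen_img (f := qv) _ xH.
    by move=> _ /allpairsP[p [_ _ ->]]; eexists.
  by exists w; apply: val_inj; apply: etrans (piHE w) wE.
have Hconic : conic H.
  apply: (@conic_joint _ H model (fun M => mod_conic M)
    (fun M => mod_in M \o eH M)) => [M x /H_onto[w <-]|x x0].
    by have := mod_in_gen M w; rewrite -eHp.
  apply: eH_inj => M; apply: (@mod_in_inj _ _ _ _ _ _ _ M).
  by rewrite raddf0; apply: x0.
by exists (CQSpace Hconic), pH, eH.
Qed.

Lemma initial_object : bijective tauhat ->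
  has_initial (Upsilon a b b' tauhat).
Proof.
move=> hbij; have [M0] := trivial_model.
have [H [pH [eH [pH_gen H_onto eHp eH_inj]]]] := universal_qspace M0.
(* The space P is the H^phi of the object under construction. It is a subspace
   of H that exhausts H but is not equal to it as a type, so tau and psi are
   built on P and psi is then composed with the inclusion vP. *)
pose h (i : 'I_n) (j : 'I_m) : H := pH (b' j ⊗ a i).
pose P : qspace K := gen_qspace (allpairs h (enum 'I_n) (enum 'I_m)).
have [piP piPE] := @gen_corestrict K H _ BA pH (dual_tens_img ha hb hb' pH).
pose pP : {linear BA -> P} := subsp_val \o piP.
pose vP : {lrmorphism P -> H} := subal_val.
have vPpP w : vP (pP w) = pH w by exact: piPE.
pose e M : {lrmorphism P -> mod_alg M} := eH M \o vP.
have e_pi M w : e M (pP w) = mod_pi M w by rewrite -eHp -vPpP.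
have e_inj x : (forall M, e M x = 0) -> x = 0.
  by move=> x0; apply: val_inj; apply: eH_inj.
have pP_gen w : pP w \in qgen P by exact: (valP (piP w)).
have P_onto x : x \in qgen P -> exists w, pP w = x.
  move=> xP; have [|w wE] := gen_qgen_img (f := pH) _ xP.
    by move=> _ /allpairsP[p [_ _ ->]]; eexists.
  by exists w; apply: val_inj; apply: etrans (piPE w) wE.
have [tau tauE] := exists_tau P_onto e_pi e_inj.
have [psi psiE] := exists_psi e_pi e_inj tauE.
have cpsi := lift_circ_morph pP_gen e_pi e_inj tauE psiE.
pose phi : {linear A -> tens H B} := tmap vP idfun \o psi.
have vP_gen x : x \in qgen P -> vP x \in qgen H.
  by move=> /P_onto[w <-]; rewrite vPpP.
have phi_homog k x : qcomp A k x -> phi x \in tsub (qcomp H k) (qcomp B k).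
  move=> xk; apply: (tsub_tmap (X := qcomp P k) (Y := qcomp B k)) => //.
    exact: qcomp_morph.
  exact: (lift_psi_homog pP_gen P_onto e_pi e_inj tauE psiE).
have phi_circ x : phi x \in circ H B.
  elim/qcomp_ind: x => [k x /phi_homog/circ_homog //|c x y].
  move=> /asboolP xS /asboolP yS; apply/asboolP => S S1 SM SX; rewrite linearP.
  by apply: rpredD; [apply/rpredZ/xS|apply: yS].
pose X : comma A B := @Comma K A B H phi phi_circ phi_homog.
have hcoef : @is_coef K A B n m a b X h.
  move=> i; rewrite [LHS](congr1 (tmap vP idfun)
    (lift_psi_gen e_pi e_inj psiE (a i))) raddf_sum.
  by apply: eq_bigr => j _; rewrite /h -vPpP; apply: tmapE.
have tw : twisting tau := lift_twisting e_inj tauE.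
exists X; split.
  exists h; split=> //; exists piP; split; first by move=> i j; apply: piPE.
  have [th [thE tauth]] := exists_tauhat_phi P_onto e_pi e_inj tauE
    (fun w => erefl (pP w)).
  exists th; split=> //; exists tau; split=> //.
  - exact: (lift_symmetric pP_gen P_onto e_pi e_inj tauE hbij).
  - by exists psi.
move=> Y /(model_of_Upsilon ha hb hb')[M [v [phiY vgen]]].
pose f : {lrmorphism H -> comma_H Y} := v \o eH M.
have f_gen x : x \in qgen H -> f x \in qgen (comma_H Y).
  by move=> /H_onto[w <-]; rewrite [f _](congr1 v (eHp M w)).
have f_comm x : comma_phi Y x = tmap f idfun (phi x).
  by rewrite phiY -psiE; apply: tmap_square.
exists (@CommaArrow K A B X Y (@QMorph K H (comma_H Y) f f_gen) f_comm) => g x.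
have gf w : g (pH w) = f (pH w).
  pose gp : {linear BA -> comma_H Y} := g \o pH.
  pose fp : {linear BA -> comma_H Y} := f \o pH.
  apply: (dual_tens_ext ha hb hb' (f := gp) (g := fp)) => i.
  apply: (coord_uniq hb').
  have phiE (k : {lrmorphism H -> comma_H Y}) :
    tmap k idfun (phi (subsp_val (a i))) =
      \sum_j k (h i j) ⊗ subsp_val (b j).
    by rewrite (hcoef i) raddf_sum; apply: eq_bigr => j _; apply: tmapE.
  by rewrite -(phiE g) -(phiE f) -f_comm; apply/esym/(comma_comm g).
elim/(@qspace_ind K H): x => [x /H_onto[w <-]||c x y xE yE|x y xE yE] //.
- by rewrite !rmorph1.
- by rewrite [LHS]linearP [RHS]linearP; congr (_ *: _ + _).
- by rewrite [LHS]rmorphM [RHS]rmorphM; congr (_ * _).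
Qed.
End Initial.

Theorem theorem2 (R : realType) (K : fieldType)
    (hK : K = R :> fieldType \/ K = R[i] :> fieldType)
    (A B : cqspace K)
    (n m : nat) (a : 'I_n -> qgenT A) (b : 'I_m -> qgenT B)
    (b' : 'I_m -> dual (qgenT B))
    (ha : basis a) (hb : basis b) (hb' : dual_basis b b')
    (tauhat :
      {linear tens (qgenT B) (tens (dual (qgenT B)) (qgenT A)) ->
              tens (qgenT B) (tens (dual (qgenT B)) (qgenT A))})
    (tauhat_bij : bijective tauhat) :
  has_initial (Upsilon a b b' tauhat).
Proof.
exact: initial_object.
Qed.
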